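(* Let $a,b,c$ be positive integers with $a,b>1$, and let $G$ be a finite abelian group of order $abc$. Then an MRS$_G(a,b;c)$ exists if and only if both of the following hold: (i) either $a\equiv b\equiv 0\pmod 2$, or the Sylow $2$-subgroup of $G$ is trivial or noncyclic; and (ii) if $2\in\{a,b\}$, then $ab\equiv 0\pmod 4$.
   Context: For a finite abelian group $(G,+)$ of order $abc$, a $G$-magic rectangle set MRS$_G(a,b;c)$ is a collection of $c$ arrays of size $a\times b$ whose entries are elements of $G$, each element of $G$ appearing exactly once among all the arrays, such that every row sum in every array equals a fixed constant $\gamma\in G$ and every column sum in every array equals a fixed constant $\delta\in G$. *)

(* Defs.v *)
From HB Require Import structures.
From mathcomp Require Import all_boot all_algebra all_fingroup all_solvable.

Set Implicit Arguments.
Unset Strict Implicit.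
Unset Printing Implicit Defensive.

Import GRing.Theory.
Local Open Scope ring_scope.

(* The family [M] of [c] arrays of size [a] x [b] over the additive group [G]
   is a G-magic rectangle set; a triple [(k, i, j)] is the cell in row [i] and
   column [j] of the [k]-th array. *)
Definition is_MRS (G : finZmodType) (a b c : nat)
    (M : 'I_c -> 'M[G]_(a, b)) : Prop :=
  [/\ forall g : G, exists! p : 'I_c * 'I_a * 'I_b, M p.1.1 p.1.2 p.2 = g,
      exists gamma : G, forall (k : 'I_c) (i : 'I_a), \sum_(j < b) M k i j = gamma
    & exists delta : G, forall (k : 'I_c) (j : 'I_b), \sum_(i < a) M k i j = delta].

(* Main.v *)
Require Import Defs.
From HB Require Import structures.
From mathcomp Require Import all_boot all_algebra all_fingroup all_solvable.
From mathcomp Require Import zify.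

(**
Necessity. If [a] is odd, the column sums show that the sum [S] of all elements
of [G] satisfies [a S = |G| del = 0]; but a cyclic nontrivial Sylow 2-subgroup
makes [S] the unique involution. If [a = 2] and [b] is odd, then [del = 2 x] for
some [x], and [x] occurs twice in its column.

Sufficiency. Arrays can be stacked, so it suffices to treat the sizes [2 x 2],
[p x q] and [p x 4], for odd primes [p] and [q]. The first case is a free action of a
four-group on [G]. For the others, arrays are built in a quotient [G / C] and
lifted to [G] by means of three bijections of [C] with sum zero; these exist when
[|C|] is odd, or when [C] contains a Klein group [V], by lifting a double cover of
[C / V]. The quotient has order [pq] in the second case. In the third case it
is the product of [Z/p] and of [Z/2 x Z/2^k] or [(Z/2)^3]: the Klein subgroup and
two groups of order 8 use explicit tables, and the part of [Z/2 x Z/2^k]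
outside its Klein subgroup is filled uniformly.
*)

Set Implicit Arguments.
Unset Strict Implicit.
Unset Printing Implicit Defensive.

Import GRing.Theory.
Local Open Scope ring_scope.

(** * Families of arrays *)

(** Lifting dictates the choice of the quotients. Three bijections of [C] with sum zero, summed over
    [C], give [3 S = 0], where [S] is the sum of all elements of [C]; since also [2 S = 0], this
    forces [S = 0], which excludes every kernel with a cyclic nontrivial Sylow 2-subgroup. The
    2-part of the quotient is therefore chosen so that what is left of the Sylow 2-subgroup in [C]
    is trivial or noncyclic. A Sylow 2-subgroup [Z/2 x Z/2^k] goes entirely into the quotient, and
    as [k] is unbounded, finitely many tables do not suffice: this is the origin of the uniform
    filling off the Klein subgroup. The group [(Z/2)^3] is the other one that has to be taken whole.
    The basic size is [p x 4] because (ii) forbids [p x 2]. *)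

Definition inj3 (X K I J : Type) (F : K -> I -> J -> X) : Prop :=
  forall k i j k' i' j', F k i j = F k' i' j' -> [/\ k = k', i = i' & j = j'].

(** Only injectivity is asked, so that families with disjoint ranges can be united; bijectivity onto
    [G] comes back by counting. With arbitrary finite index types, stacking is a product and union a
    sum. *)
Definition tiles (G : zmodType) (S : pred G) (gam del : G) (K I J : finType) : Prop :=
  exists F : K -> I -> J -> G,
    [/\ inj3 F, forall k i j, S (F k i j),
        forall k i, \sum_j F k i j = gam & forall k j, \sum_i F k i j = del].

Lemma finType_bij (A B : finType) :
  #|A| = #|B| -> exists f : A -> B, exists2 g, cancel f g & cancel g f.
Proof.
move=> eqAB; exists (fun x => enum_val (cast_ord eqAB (enum_rank x))).
exists (fun y => enum_val (cast_ord (esym eqAB) (enum_rank y))) => x.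
  by rewrite enum_valK cast_ordK enum_rankK.
by rewrite enum_valK cast_ordKV enum_rankK.
Qed.

Lemma tiles_reindex (G : zmodType) (S : pred G) gam del (K I J K' I' J' : finType) :
  #|K| = #|K'| -> #|I| = #|I'| -> #|J| = #|J'| ->
  tiles S gam del K I J -> tiles S gam del K' I' J'.
Proof.
move=> /esym/finType_bij[fk [gk fkK gkK]] /esym/finType_bij[fi [gi fiK giK]].
move=> /esym/finType_bij[fj [gj fjK gjK]] [F [injF FS rowF colF]].
exists (fun k i j => F (fk k) (fi i) (fj j)); split=> //.
- move=> k i j k' i' j' /injF[].
  by move=> /(can_inj fkK)-> /(can_inj fiK)-> /(can_inj fjK)->.
- by move=> k i; rewrite -(rowF (fk k) (fi i)) [RHS](reindex fj) //; exists gj.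
- by move=> k j; rewrite -(colF (fk k) (fj j)) [RHS](reindex fi) //; exists gi.
Qed.

Lemma tiles_tr (G : zmodType) (S : pred G) gam del (K I J : finType) :
  tiles S gam del K I J -> tiles S del gam K J I.
Proof.
case=> F [injF FS rowF colF]; exists (fun k j i => F k i j); split=> //.
by move=> k i j k' i' j' /injF[].
Qed.

Lemma tiles_stack (G : zmodType) (S : pred G) gam del (K L I J : finType) :
  tiles S gam del (K * L)%type I J -> tiles S gam (del *+ #|L|) K (L * I)%type J.
Proof.
case=> F [injF FS rowF colF]; exists (fun k i j => F (k, i.1) i.2 j); split=> //.
- by move=> k [l i] j k' [l' i'] j' /injF /= [[-> ->] -> ->].
- move=> k j; rewrite -(pair_bigA _ (fun l i => F (k, l) i j)) /=.
  by under eq_bigr do rewrite colF; rewrite sumr_const.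
Qed.

Lemma tilesU (G : zmodType) (S1 S2 : pred G) gam del (K1 K2 I J : finType) :
    (forall x, S1 x -> ~~ S2 x) -> tiles S1 gam del K1 I J -> tiles S2 gam del K2 I J ->
  tiles (predU S1 S2) gam del (K1 + K2)%type I J.
Proof.
move=> dis [F1 [inj1 FS1 row1 col1]] [F2 [inj2 FS2 row2 col2]].
have neq12 k1 i1 j1 k2 i2 j2 : F1 k1 i1 j1 <> F2 k2 i2 j2.
  by move=> eqF; have /negP[] := dis _ (FS1 k1 i1 j1); rewrite eqF.
exists (fun k => match k with inl k => F1 k | inr k => F2 k end); split.
- move=> [k|k] i j [k'|k'] i' j'; first by case/inj1=> -> -> ->.
  + by move/neq12.
  + by move/esym/neq12.
  + by case/inj2=> -> -> ->.
- by move=> [k|k] i j; rewrite /= ?FS1 ?FS2 ?orbT.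
- by case.
- by case.
Qed.

Definition tileable (G : finZmodType) (a b c : nat) : Prop :=
  exists gam del : G, tiles xpredT gam del 'I_c 'I_a 'I_b.

Lemma tileableP (G : finZmodType) (gam del : G) (K I J : finType) :
  tiles xpredT gam del K I J -> tileable G #|I| #|J| #|K|.
Proof.
move=> tF; exists gam, del.
by apply: tiles_reindex tF; rewrite card_ord.
Qed.

Lemma tileable_tr (G : finZmodType) a b c : tileable G a b c -> tileable G b a c.
Proof. by case=> gam [del tF]; exists del, gam; apply: tiles_tr. Qed.

Lemma tileable_stack (G : finZmodType) a b c l :
  tileable G a b (c * l) -> tileable G (l * a) b c.
Proof.
case=> gam [del tF]; exists gam, (del *+ #|'I_l|).
have: tiles xpredT gam del ('I_c * 'I_l)%type 'I_a 'I_b.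
  by apply: tiles_reindex tF; rewrite ?card_prod ?card_ord.
by move/tiles_stack; apply: tiles_reindex; rewrite ?card_prod ?card_ord.
Qed.

Lemma tileable_MRS (G : finZmodType) a b c :
  #|G| = (a * b * c)%N -> tileable G a b c -> exists M : 'I_c -> 'M[G]_(a, b), is_MRS M.
Proof.
move=> cardG [gam [del [F [injF _ rowF colF]]]].
exists (fun k => \matrix_(i, j) F k i j); split; last 2 first.
- by exists gam => k i; under eq_bigr do rewrite mxE; apply: rowF.
- by exists del => k j; under eq_bigr do rewrite mxE; apply: colF.
pose f (p : 'I_c * 'I_a * 'I_b) := F p.1.1 p.1.2 p.2.
have injf : injective f by move=> [[k i] j] [[k' i'] j'] /injF /= [-> -> ->].
have cardf : #|{: 'I_c * 'I_a * 'I_b}| = #|G|.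
  by rewrite !card_prod !card_ord cardG; lia.
have [g fK gK] := inj_card_bij injf (eq_leq (esym cardf)).
move=> h; exists (g h); split=> [|p]; first by rewrite mxE -[F _ _ _]/(f _) gK.
by rewrite mxE -[F _ _ _]/(f _) => <-; rewrite fK.
Qed.

(** * Arrays modulo a subgroup *)

Section Subgroups.
Variable G : finZmodType.
Implicit Types (C D V : {group G}) (x y : G).

Lemma mem0 C : (0 : G) \in C. Proof. exact: group1. Qed.
Lemma memD C x y : x \in C -> y \in C -> x + y \in C. Proof. exact: groupM. Qed.
Lemma memN C x : (- x \in C) = (x \in C). Proof. exact: groupV. Qed.
Lemma memB C x y : x \in C -> y \in C -> x - y \in C.
Proof. by move=> Cx Cy; rewrite memD ?memN. Qed.
Lemma memMn C x n : x \in C -> x *+ n \in C. Proof. exact: groupX. Qed.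
Lemma memDl C x y : x \in C -> (x + y \in C) = (y \in C).
Proof. exact: groupMl. Qed.
Lemma memDr C x y : x \in C -> (y + x \in C) = (y \in C).
Proof. exact: groupMr. Qed.
Lemma mem_sum C (I : finType) (P : pred I) (F : I -> G) :
  (forall i, P i -> F i \in C) -> \sum_(i | P i) F i \in C.
Proof.
move=> CF; elim/big_ind: _ => //; first exact: mem0.
by move=> x y; apply: memD.
Qed.
Lemma memBC C x y : (x - y \in C) = (y - x \in C).
Proof. by rewrite -memN opprB. Qed.
Lemma memB_trans C x y z : x - y \in C -> y - z \in C -> x - z \in C.
Proof. by move=> Cxy Cyz; rewrite -[x - z](subrKA y) memD. Qed.

Lemma marginals C (I J : finType) (r : I -> G) (c : J -> G) (i0 : I) (j0 : J) :
    (forall i, r i \in C) -> (forall j, c j \in C) -> \sum_i r i = \sum_j c j ->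
  exists t : I -> J -> G, [/\ forall i j, t i j \in C,
    forall i, \sum_j t i j = r i & forall j, \sum_i t i j = c j].
Proof.
move=> Cr Cc eqrc.
(* Everything outside row [i0] and column [j0] is zero; equality of the two totals lets the corner
   entry serve both its row and its column. *)
pose t i j := if j == j0 then if i == i0 then r i0 - \sum_(j | j != j0) c j else r i
              else if i == i0 then c j else 0.
exists t; split=> [i j|i|j]; rewrite /t.
- by do 2!case: ifP => _; rewrite ?mem0 // memB // mem_sum.
- rewrite (bigD1 j0) //= eqxx; case: eqP => [->|_].
    by rewrite [X in _ + X](eq_bigr c) ?subrK // => j /negPf->.
  by rewrite big1 ?addr0 // => j /negPf->.
- rewrite (bigD1 i0) //= eqxx; case: eqP => [->|_].
    rewrite [X in _ + X](eq_bigr r) => [|i /negPf-> //].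
    by rewrite addrAC; move: eqrc; rewrite (bigD1 i0) // (bigD1 j0) //= => ->; rewrite addrK.
  by rewrite big1 ?addr0 // => i /negPf->.
Qed.

(* The index l enumerates C, so every cell of the table is a bijection l |-> f l i j onto C. *)
Definition bij_table C (I J : finType) : Prop :=
  exists f : 'I_#|C| -> I -> J -> G,
    [/\ forall l i j, f l i j \in C, forall i j, injective (fun l => f l i j),
        forall l i, \sum_j f l i j = 0 & forall l j, \sum_i f l i j = 0].

(* Arrays modulo C become arrays in G: representatives are first corrected cell by cell, within C, to have the exact row and column sums, then spread over their cosets of C by a zero-sum table of bijections. *)
Lemma lift_tiles C (gam del : G) (K I J : finType) (F : K -> I -> J -> G) :
    (forall k i j k' i' j', F k i j - F k' i' j' \in C -> [/\ k = k', i = i' & j = j']) ->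
    (forall k i, gam - \sum_j F k i j \in C) ->
    (forall k j, del - \sum_i F k i j \in C) ->
    gam *+ #|I| = del *+ #|J| -> (0 < #|I|)%N -> (0 < #|J|)%N -> bij_table C I J ->
  tiles xpredT gam del (K * 'I_#|C|)%type I J.
Proof.
move=> injF rowF colF eqgd /card_gt0P[i0 _] /card_gt0P[j0 _] [f [Cf injf rowf colf]].
have t_ k : exists t : I -> J -> G, [/\ forall i j, t i j \in C,
    forall i, \sum_j t i j = gam - \sum_j F k i j
  & forall j, \sum_i t i j = del - \sum_i F k i j].
  apply: marginals i0 j0 _ _ _ => //; rewrite !sumrB !sumr_const eqgd.
  by rewrite exchange_big.
have [t tP] := fin_all_exists t_.
exists (fun k i j => F k.1 i j + t k.1 i j + f k.2 i j); split=> [|//||].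
- move=> [k l] i j [k' l'] i' j' /= eqF.
  have Ct k1 i1 j1 : t k1 i1 j1 \in C by have [] := tP k1.
  have /injF[ek ei ej] : F k i j - F k' i' j' \in C.
    have -> : F k i j - F k' i' j' = t k' i' j' + f l' i' j' - (t k i j + f l i j).
      have /(canRL (addrK _)) -> : F k i j + (t k i j + f l i j) =
        F k' i' j' + (t k' i' j' + f l' i' j') by rewrite !addrA.
      by rewrite addrAC [F k' i' j' + _]addrC addrK.
    by rewrite memB ?memD.
  move: eqF; rewrite ek ei ej => /addrI/injf->.
  by [].
- move=> [k l] i /=; have [_ tr _] := tP k.
  by rewrite !big_split /= tr rowf addr0 addrC subrK.
- move=> [k l] j /=; have [_ _ tc] := tP k.
  by rewrite !big_split /= tc colf addr0 addrC subrK.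
Qed.

End Subgroups.

(** * Zero-sum tables of bijections *)

Section BijTables.
Variables (G : finZmodType) (C : {group G}).

(** Equivalent to a complete mapping of [C]: [phi 0], [phi 1] and their sum [- phi 2] are all
    bijections onto [C]. *)
Definition zero_sum_bij3 : Prop :=
  exists phi : 'I_3 -> 'I_#|C| -> G,
    [/\ forall r l, phi r l \in C, forall r, injective (phi r)
      & forall l, \sum_r phi r l = 0].

Lemma bij_table_reindex (I J I' J' : finType) :
  #|I| = #|I'| -> #|J| = #|J'| -> bij_table C I J -> bij_table C I' J'.
Proof.
move=> /esym/finType_bij[fi [gi fiK giK]] /esym/finType_bij[fj [gj fjK gjK]].
move=> [f [Cf injf rowf colf]].
exists (fun l i j => f l (fi i) (fj j)); split=> //.
- by move=> l i; rewrite -[RHS](rowf l (fi i)) [RHS](reindex fj) //; exists gj.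
- by move=> l j; rewrite -[RHS](colf l (fj j)) [RHS](reindex fi) //; exists gi.
Qed.

Lemma bij_table_tr (I J : finType) : bij_table C I J -> bij_table C J I.
Proof. by case=> f [Cf injf rowf colf]; exists (fun l j i => f l i j); split. Qed.

Lemma bij_table_cat (I J1 J2 : finType) :
  bij_table C I J1 -> bij_table C I J2 -> bij_table C I (J1 + J2)%type.
Proof.
case=> f [Cf injf rowf colf] [g [Cg injg rowg colg]].
exists (fun l i j => match j with inl j => f l i j | inr j => g l i j end).
split; first by move=> l i [].
- by move=> i [].
- by move=> l i; rewrite big_sumType /= rowf rowg addr0.
- by move=> l [].
Qed.

Lemma bij_table_catn a b b' :
  bij_table C 'I_a 'I_b -> bij_table C 'I_a 'I_b' -> bij_table C 'I_a 'I_(b + b').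
Proof.
move=> t1 t2; apply: bij_table_reindex (bij_table_cat t1 t2) => //.
by rewrite card_sum !card_ord.
Qed.

Lemma bij_table22 : zero_sum_bij3 -> bij_table C 'I_2 'I_2.
Proof.
case=> phi [Cphi injphi _].
apply: (@bij_table_reindex bool bool); rewrite ?card_bool ?card_ord //.
exists (fun l i j => if i == j then phi 0 l else - phi 0 l); split.
- by move=> l i j; case: ifP; rewrite ?memN.
- by move=> i j l l'; case: ifP => _; [|move/oppr_inj]; apply: injphi.
- by move=> l []; rewrite big_bool /= ?addrN ?addNr.
- by move=> l []; rewrite big_bool /= ?addrN ?addNr.
Qed.

Lemma bij_table23 : zero_sum_bij3 -> bij_table C 'I_2 'I_3.
Proof.
case=> phi [Cphi injphi sumphi].
apply: (@bij_table_reindex bool 'I_3); rewrite ?card_bool ?card_ord //.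
exists (fun l (i : bool) j => if i then phi j l else - phi j l); split.
- by move=> l i j; case: ifP; rewrite ?memN.
- by move=> i j l l'; case: ifP => _; [|move/oppr_inj]; apply: injphi.
- by move=> l []; rewrite ?sumrN sumphi ?oppr0.
- by move=> l j; rewrite big_bool /= addrN.
Qed.

(** The three bijections are arranged in a cyclic Latin square. *)
Lemma bij_table33 : zero_sum_bij3 -> bij_table C 'I_3 'I_3.
Proof.
case=> phi [Cphi injphi sumphi].
exists (fun l (i j : 'I_3) => phi (i + j) l); split=> //.
- move=> l i; rewrite -[RHS](sumphi l) [RHS](reindex_inj (addrI i)) //.
- move=> l j; rewrite -[RHS](sumphi l) [RHS](reindex_inj (addIr j)) //.
Qed.

Lemma bij_table_ge2 a b : zero_sum_bij3 -> (1 < a)%N -> (1 < b)%N -> bij_table C 'I_a 'I_b.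
Proof.
move=> hp a1 b1.
(* Every [n > 1] is a sum of 2s and 3s, so widths 2 and 3 give all widths. *)
have ext d : bij_table C 'I_d 'I_2 -> bij_table C 'I_d 'I_3 ->
    forall n, (1 < n)%N -> bij_table C 'I_d 'I_n.
  move=> t2 t3; elim/ltn_ind=> -[|[|[|[|n]]]] IH // _.
  by apply: (@bij_table_catn d 2 n.+2) => //; apply: IH.
have t22 := bij_table22 hp; have t23 := bij_table23 hp; have t33 := bij_table33 hp.
have t2 := ext _ t22 t23 _ a1; have t3 := ext _ (bij_table_tr t23) t33 _ a1.
exact: ext (bij_table_tr t2) (bij_table_tr t3) _ b1.
Qed.

Lemma zero_sum_bij3_fin (L : finType) (f g : L -> G) :
    #|L| = #|C| -> injective f -> injective g -> injective (fun l => f l + g l) ->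
    (forall l, f l \in C) -> (forall l, g l \in C) -> zero_sum_bij3.
Proof.
move=> cardL injf injg injfg Cf Cg.
have [|h [h' hK h'K]] := @finType_bij 'I_#|C| L; first by rewrite card_ord.
exists (fun r l => if r == 0 then f (h l) else if r == 1 then g (h l) else - (f (h l) + g (h l))).
split=> [r l|r l l'|l].
- by case: ifP => _; [|case: ifP => _]; rewrite ?memN ?memD.
- case: ifP => _; first by move/injf/(can_inj hK).
  case: ifP => _; first by move/injg/(can_inj hK).
  by move/oppr_inj/injfg/(can_inj hK).
- by rewrite !big_ord_recl big_ord0 /= addr0 addrA addrN.
Qed.

(** With both [f] and [g] the identity of [C], [f + g] is doubling, which is injective in odd
    order. *)
Lemma zero_sum_bij3_odd : odd #|C| -> zero_sum_bij3.
Proof.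
move=> oddC; pose f (l : 'I_#|C|) := enum_val l.
have Cf l : f l \in C by apply: enum_valP.
apply: (@zero_sum_bij3_fin 'I_#|C| f f); rewrite ?card_ord //; try exact: enum_val_inj.
move=> l l' eqff; apply: enum_val_inj; apply/eqP; rewrite -subr_eq0 -/(f l) -/(f l').
set d := f l - f l'.
have Cd : d \in C by rewrite memB.
have d2 : d *+ 2 = 0 by rewrite mulrnBl !mulr2n eqff subrr.
have ord2 : (#[d]%g %| 2)%N by rewrite order_dvdn; apply/eqP.
have : (#[d]%g %| gcdn 2 #|C|)%N by rewrite dvdn_gcd ord2 order_dvdG.
have /eqP-> : coprime 2 #|C| by rewrite coprime2n.
by rewrite dvdn1 order_eq1; apply.
Qed.

End BijTables.

(** * Three bijections with sum zero *)

Section Growth.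
Variable G : finZmodType.
Implicit Types (A B : {group G}) (x s : G).

Lemma zabelian (A : {set G}) : abelian A.
Proof. by apply/centsP=> x _ y _; apply: addrC. Qed.

Lemma subg_norm (A B : {group G}) : A \subset B -> (A <| B)%g.
Proof. by move=> sAB; rewrite -sub_abelian_normal // zabelian. Qed.

Lemma index_mul_mem A B x : A \subset B -> x \in B -> x *+ #|B : A|%g \in A.
Proof.
move=> sAB Bx; have nAB := normal_norm (subg_norm sAB).
have nAx := subsetP nAB x Bx.
apply: coset_idr; first by rewrite groupX.
rewrite -[x *+ _]/((x ^+ _)%g) morphX //; apply/eqP.
by rewrite -order_dvdn -card_quotient // order_dvdG // mem_quotient.
Qed.

Lemma two_mul_mem A x n : x \notin A -> x *+ (2 ^ n) \in A ->
  exists k, x *+ (2 ^ k) \notin A /\ (x *+ (2 ^ k)) *+ 2 \in A.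
Proof.
elim: n => [|n IHn] Ax; first by rewrite expn0 mulr1n (negPf Ax).
have [An _|nA xA] := boolP (x *+ (2 ^ n) \in A); first exact: IHn.
by exists n; split=> //; rewrite -mulrnA mulnC -expnS.
Qed.

Lemma double_group A s : s \notin A -> s *+ 2 \in A ->
  exists B : {group G}, #|B| = (2 * #|A|)%N /\ forall x, (x \in B) = (x \in A) || (x - s \in A).
Proof.
move=> As As2; pose S := [set x | (x \in A) || (x - s \in A)].
have gS : group_set S.
  apply/group_setP; split=> [|x y]; first by rewrite inE group1.
  rewrite !inE FinRing.zmodMgE => /orP[] Ax /orP[] Ay.
  - by apply/orP; left; apply: memD.
  - by apply/orP; right; rewrite -addrA; apply: memD.
  - by apply/orP; right; rewrite addrAC; apply: memD.
  - apply/orP; left; rewrite -[x + y](subrK (s *+ 2)); apply: memD => //.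
    by rewrite mulr2n opprD addrACA; apply: memD.
exists (Group gS); split=> [|x]; last by rewrite inE.
have -> : Group gS = A :|: [set a + s | a in A] :> {set G}.
  apply/setP=> x; rewrite !inE; congr (_ || _); apply/idP/imsetP => [Ax|[a Aa ->]].
    by exists (x - s); rewrite ?subrK.
  by rewrite addrK.
rewrite cardsU card_imset ?mul2n ?addnn; last exact: addIr.
suff -> : A :&: [set a + s | a in A] = set0 by rewrite cards0 subn0.
apply/setP=> x; rewrite !inE; apply/negP=> /andP[Ax /imsetP[a Aa def_x]].
by case/negP: As; rewrite -(memDl s Aa) -def_x.
Qed.

(** A chain of subgroups, each of index 2 in the next, leads from [A] to [B]: any element of [B]
    outside the current group has a multiple by a power of 2 that is still outside while its double
    is inside. *)
Lemma grow_ind (P : {group G} -> Prop) A B n :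
    (forall A s B, s \notin A -> s *+ 2 \in A -> #|B| = (2 * #|A|)%N ->
       (forall x, (x \in B) = (x \in A) || (x - s \in A)) -> P A -> P B) ->
  A \subset B -> #|B| = (2 ^ n * #|A|)%N -> P A -> P B.
Proof.
move=> stepP; elim: n A => [|n IHn] A sAB cardB PA.
  suff -> : B = A by [].
  by apply/val_inj/esym/eqP; rewrite eqEcard sAB cardB mul1n leqnn.
have ltAB : (#|A| < #|B|)%N.
  by rewrite cardB ltn_Pmull ?cardG_gt0 // -{1}(expn0 2) ltn_exp2l.
have /subsetPn[x Bx Ax] : ~~ (B \subset A).
  by apply: contraL ltAB => /subset_leq_card; rewrite -leqNgt.
have indexB : #|B : A|%g = (2 ^ n.+1)%N.
  by apply/eqP; rewrite -(eqn_pmul2l (cardG_gt0 A)) Lagrange // cardB mulnC.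
have := index_mul_mem sAB Bx; rewrite indexB => /(two_mul_mem Ax)[k [As As2]].
have [A' [cardA' inA']] := double_group As As2.
apply: (IHn A'); last exact: stepP As As2 cardA' inA' PA.
- apply/subsetP=> y; rewrite inA' => /orP[/(subsetP sAB)//|/(subsetP sAB)].
  by rewrite memDr // memN memMn.
- by rewrite cardA' cardB expnSr mulnA.
Qed.

Lemma coset_reps (D H : {group G}) (T : finType) :
    D \subset H -> #|H| = (#|D| * #|T|)%N ->
  exists s : T -> G, (forall t, s t \in H) /\ (forall t t', s t - s t' \in D -> t = t').
Proof.
move=> sDH cardH; pose R := rcosets D H.
have cardR : #|{: 'I_#|R|}| = #|T|.
  by apply/eqP; rewrite card_ord -(eqn_pmul2l (cardG_gt0 D)) Lagrange // cardH.
have [f [g fK gK]] := finType_bij (esym cardR).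
pose u (k : 'I_#|R|) := repr (enum_val k).
have uP k : exists2 x, x \in H & enum_val k = (D :* x)%g /\ u k - x \in D.
  have /rcosetsP[x Hx defk] := enum_valP k; exists x; rewrite // /u defk; split=> //.
  by have := mem_repr x (rcoset_refl D x); rewrite mem_rcoset.
exists (fun t => u (f t)); split=> [t|t t' Dtt'].
  by have [x Hx [_ /(subsetP sDH)]] := uP (f t); rewrite memDr // memN.
apply: (can_inj fK); have [x _ [defk Dx]] := uP (f t); have [y _ [defk' Dy]] := uP (f t').
apply: enum_val_inj; rewrite defk defk'; apply/rcoset_eqP; rewrite mem_rcoset.
apply: (memB_trans (y := u (f t))); first by rewrite memBC.
exact: memB_trans Dtt' Dy.
Qed.

End Growth.

(** * Double covers modulo a Klein subgroup *)

Section Klein.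
Variables (G : finZmodType) (w z : G).

Definition klein_pair : bool := [&& w != 0, z != 0, w != z, w *+ 2 == 0 & z *+ 2 == 0].

Hypothesis wz : klein_pair.

Let w0 : w == 0 = false. Proof. by case/and5P: wz => /negPf. Qed.
Let z0 : z == 0 = false. Proof. by case/and5P: wz => _ /negPf. Qed.
Let w_z : w == z = false. Proof. by case/and5P: wz => _ _ /negPf. Qed.
Let w2 : w + w = 0. Proof. by case/and5P: wz => _ _ _ /eqP <-. Qed.
Let z2 : z + z = 0. Proof. by case/and5P: wz => _ _ _ _ /eqP <-. Qed.

Let Nw : - w = w. Proof. by apply/eqP; rewrite eq_sym -addr_eq0 w2. Qed.
Let Nz : - z = z. Proof. by apply/eqP; rewrite eq_sym -addr_eq0 z2. Qed.

Definition klein_elt (a b : bool) : G := w *+ a + z *+ b.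
Arguments klein_elt : simpl never.

Lemma klein_eltD a b a' b' :
  klein_elt a b + klein_elt a' b' = klein_elt (a (+) a') (b (+) b').
Proof.
rewrite /klein_elt addrACA.
by case: a a' b b' => [] [] [] []; rewrite ?mulr1n ?mulr0n ?w2 ?z2 ?addr0 ?add0r.
Qed.

Lemma addr_klein_eltD x a b a' b' :
  x + klein_elt a b + klein_elt a' b' = x + klein_elt (a (+) a') (b (+) b').
Proof. by rewrite -klein_eltD; apply/esym/addrA. Qed.

Lemma klein_eltN a b : - klein_elt a b = klein_elt a b.
Proof. by case: a b => [] []; rewrite /klein_elt opprD ?mulr1n ?mulr0n ?Nw ?Nz ?oppr0. Qed.

Lemma klein_elt_eq0 a b : (klein_elt a b == 0) = ~~ a && ~~ b.
Proof.
case: a b => [] []; rewrite /klein_elt ?mulr1n ?mulr0n ?addr0 ?add0r ?w0 ?z0 ?eqxx //=.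
by rewrite addr_eq0 Nz w_z.
Qed.

Lemma klein_elt_inj a b a' b' : klein_elt a b = klein_elt a' b' -> a = a' /\ b = b'.
Proof.
move/eqP; rewrite -subr_eq0 klein_eltN klein_eltD klein_elt_eq0.
by case: a a' b b' => [] [] [] [].
Qed.

Definition klein_set : {set G} := [set klein_elt p.1 p.2 | p : bool * bool].

Lemma klein_group_set : group_set klein_set.
Proof.
apply/group_setP; split; first by apply/imsetP; exists (false, false); rewrite // /klein_elt !mulr0n addr0.
move=> x y /imsetP[[a b] _ ->] /imsetP[[a' b'] _ ->].
by apply/imsetP; exists (a (+) a', b (+) b'); rewrite // FinRing.zmodMgE klein_eltD.
Qed.

Canonical klein_group := Group klein_group_set.

Local Notation V := [group of klein_set].

Lemma klein_eltP x : reflect (exists a b, x = klein_elt a b) (x \in V).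
Proof.
apply: (iffP imsetP) => [[[a b] _ ->]|[a [b ->]]]; first by exists a, b.
by exists (a, b).
Qed.

Lemma klein_elt_in a b : klein_elt a b \in V.
Proof. by apply/klein_eltP; exists a, b. Qed.

Lemma card_klein : #|V| = 4.
Proof.
rewrite card_imset ?card_prod ?card_bool // => -[a b] [a' b'] /klein_elt_inj /=.
by case=> -> ->.
Qed.

(** Depends only on the coset, so data known modulo [V] can be completed by prescribed elements of
    [V]. *)
Definition klein_rep (x : G) : G := repr (V :* x)%g.

Lemma klein_rep_sub x : x - klein_rep x \in V.
Proof.
have : klein_rep x \in (V :* x)%g by apply: mem_repr (rcoset_refl _ _).
by rewrite mem_rcoset FinRing.zmodMgE FinRing.zmodVgE memBC.
Qed.

Lemma klein_repP x y : x - y \in V -> klein_rep x = klein_rep y.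
Proof. by move=> Vxy; congr repr; apply/rcoset_eqP; rewrite mem_rcoset. Qed.

(* u and eta are 2-to-1 on K0 x bool modulo V, and so is their sum: the boolean functions separate the two points of each fibre. *)
Definition two_cover (A : {group G}) : Prop :=
  exists (K0 : finType) (u eta : K0 -> bool -> G) (ceta csum : K0 -> bool -> bool),
  [/\ (#|K0| * 4 = #|A|)%N /\ forall k b, u k b \in A /\ eta k b \in A,
      forall b k k', u k b - u k' b \in V -> k = k',
      forall k b k' b', eta k b - eta k' b' \in V -> ceta k b = ceta k' b' -> k = k' /\ b = b'
    & forall k b k' b', (u k b + eta k b) - (u k' b' + eta k' b') \in V ->
        csum k b = csum k' b' -> k = k' /\ b = b'].

(** Here [V] is the Sylow 2-subgroup of [A], so doubling is injective on [A / V]. Both [u] and [eta]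
    are one transversal, each value taken twice, and the boolean argument is its own colour. *)
Lemma two_cover_odd (A : {group G}) m : V \subset A -> #|A| = (m * 4)%N -> odd m -> two_cover A.
Proof.
move=> sVA cardA oddm.
have [|u [Au inju]] := @coset_reps G V A 'I_m sVA; first by rewrite card_klein card_ord mulnC.
have hallV : (2.-Hall(A) V)%g.
  rewrite pHallE sVA cardA card_klein partnM ?(part_pnat_id (n := 4)) //.
    by rewrite part_p'nat // p'natE // dvdn2 oddm.
  by rewrite lt0n; case: (m) oddm.
have half x : x \in A -> x *+ 2 \in V -> x \in V.
  move=> Ax /klein_eltP[a [b x2]].
  rewrite (mem_normal_Hall hallV) ?subg_norm //; apply: (@pnat_dvd _ 4) => //.
  rewrite order_dvdn -[(x ^+ 4)%g]/(x *+ (2 * 2)) mulrnA x2 mulr2n -[X in _ + X]klein_eltN.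
  by rewrite subrr.
exists 'I_m, (fun k _ => u k), (fun k _ => u k), (fun _ b => b), (fun _ b => b).
split=> //; first by rewrite card_ord cardA.
- by move=> k b k' b' /inju.
- move=> k b k' b'; rewrite -!mulr2n -mulrnBl => /half h; split=> //; apply/inju/h.
  by apply: memB.
Qed.

(* The pair (u, eta) meets the cosets of A in B in each of the four possible ways on 2|K0| points, hence again covers everything twice. *)
Lemma two_cover_step (A : {group G}) s (B : {group G}) :
    s \notin A -> s *+ 2 \in A -> #|B| = (2 * #|A|)%N ->
    (forall x, (x \in B) = (x \in A) || (x - s \in A)) -> V \subset A ->
  two_cover A -> two_cover B.
Proof.
move=> As As2 cardB inB sVA [K0 [u [eta [ceta [csum [[cardK Aue] uV etaV sumV]]]]]].
have Au k b : u k b \in A by have [] := Aue k b.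
have Ae k b : eta k b \in A by have [] := Aue k b.
pose sg (b : bool) : G := s *+ b.
(* Modulo [A], the new [u] lies in the class of [c], the new [eta] in that of [b], and their sum in
   that of [c (+) b]. The sign in [tw] makes the two shifts cancel exactly when both are present,
   instead of adding up to [s *+ 2]. *)
pose tw (c b : bool) : G := if c then (if b then - s else s) else 0.
have Asg b b' x : x \in A -> (x + (sg b - sg b') \in A) = (b == b').
  move=> Ax; rewrite memDl //; case: b b' => [] [];
    rewrite /sg ?mulr1n ?mulr0n ?subrr ?subr0 ?sub0r ?memN ?mem0 ?(negPf As) //.
have sAB x : x \in A -> x \in B by rewrite inB => ->.
have Bs : s \in B by rewrite inB subrr mem0 orbT.
have acd (p q x y : G) : (p + x) - (q + y) = (p - q) + (x - y).
  by rewrite opprD addrACA.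
have sVA' x : x \in V -> x \in A by apply: subsetP.
exists (K0 * bool)%type, (fun kc b => u kc.1 kc.2 + tw kc.2 b),
  (fun kc b => eta kc.1 kc.2 + sg b), (fun kc _ => ceta kc.1 kc.2),
  (fun kc _ => csum kc.1 kc.2); split.
- split=> [|[k c] b /=]; first by rewrite card_prod card_bool cardB -cardK; lia.
  split; rewrite memD ?(sAB _ (Au _ _)) ?(sAB _ (Ae _ _)) //.
    by case: c b => [] []; rewrite /tw ?memN ?mem0.
  by rewrite memMn.
- move=> b [k c] [k' c'] /=; rewrite acd => Vu.
  suff eqc : c = c' by move: Vu; rewrite eqc subrr addr0 => /uV->.
  move: (sVA' _ Vu); rewrite (memDl _ (memB (Au k c) (Au k' c'))).
  by case: c c' b {Vu} => [] [] [];
    rewrite // /tw /= ?subr0 ?sub0r ?opprK ?memN (negPf As).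
- move=> [k c] b [k' c'] b' /=; rewrite acd => Ve eqc.
  have /eqP eqb : b == b' by rewrite -(Asg _ _ _ (memB (Ae k c) (Ae k' c'))); apply: sVA'.
  by move: Ve; rewrite eqb subrr addr0 => /etaV/(_ eqc)[-> ->].
- move=> [k c] b [k' c'] b' /=; rewrite addrACA [X in _ - X]addrACA acd => Vs eqc.
  pose d c b := tw c b + sg b - sg (c (+) b).
  have d0 c1 b1 : d c1 b1 = 0.
    by case: c1 b1 => [] []; rewrite /d /tw /sg /= ?mulr1n ?mulr0n ?addr0 ?add0r ?addNr ?subr0 ?subrr ?oppr0.
  have twsg c1 b1 : tw c1 b1 + sg b1 = sg (c1 (+) b1) by apply/eqP; rewrite -subr_eq0 -/(d _ _) d0.
  move: Vs; rewrite !twsg => Vs.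
  have Asum : u k c + eta k c - (u k' c' + eta k' c') \in A by apply: memB; apply: memD.
  have /eqP eqcb : c (+) b == c' (+) b' by rewrite -(Asg _ _ _ Asum); apply: sVA'.
  move: Vs; rewrite eqcb subrr addr0 => /sumV/(_ eqc)[-> eqc'].
  by move: eqcb; rewrite eqc' => /addbI->.
Qed.

Lemma two_coverP (A : {group G}) : V \subset A -> two_cover A.
Proof.
move=> sVA; pose m := (#|A| %/ 4)%N.
have cardA : #|A| = (m * 4)%N by rewrite divnK //; have := cardSg sVA; rewrite card_klein.
have m_gt0 : (0 < m)%N by have := cardG_gt0 A; lia.
pose n := logn 2 m; pose m' := (m`_2^')%N.
have m'_odd : odd m' by rewrite -[odd _]negbK -dvdn2 -p'natE ?part_pnat ?part_gt0.
have defm : m = (2 ^ n * m')%N by rewrite -p_part partnC.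
(* The growth starts from [V] together with the odd part of [A]; the index of this [B] in [A] is the
   power [2 ^ n]. *)
have [B sVB [sBA cardB]] : exists2 B : {group G}, V \subset B & B \subset A /\ #|B| = (m' * 4)%N.
  pose O := 'O_(2%N^')(A)%G.
  have hallO : ((2%N^').-Hall(A) O)%g by apply: nilpotent_pcore_Hall; rewrite abelian_nil // zabelian.
  have cardO : #|O| = m'.
    rewrite (card_Hall hallO) cardA partnM // [X in (_ * X)%N = _]part_p'nat ?muln1 //.
  exists (V <*> O)%G; first exact: joing_subl.
  rewrite join_subG sVA pcore_sub; split=> //.
  rewrite /= norm_joinEr ?TI_cardMg ?card_klein ?cardO 1?mulnC //.
    by rewrite coprime_TIg // card_klein cardO -[4]/(2 ^ 2)%N coprime_pexpl // coprime2n.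
  by apply: cents_norm; apply/centsP=> x _ y _; apply: addrC.
pose P (X : {group G}) := V \subset X /\ two_cover X.
suff [] : P A by [].
apply: (@grow_ind _ P B A n) => //; last by split=> //; apply: two_cover_odd cardB _.
  move=> X s Y Xs Xs2 cardY inY [sVX tcX]; split; last exact: two_cover_step inY _ _.
  by apply/subsetP=> x /(subsetP sVX); rewrite inY => ->.
by rewrite cardB cardA defm mulnA.
Qed.

(* X is injective modulo w, Y modulo z and X + Y modulo w + z, so adding (w, z, w + z) yields bijections X, Y and X + Y of C. *)
Lemma zero_sum_bij3_klein (C : {group G}) : V \subset C -> zero_sum_bij3 C.
Proof.
move=> sVC; have [K0 [u [eta [ceta [csum [[cardK Cue] uV etaV sumV]]]]]] := two_coverP sVC.
have Cu k b : u k b \in C by have [] := Cue k b.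
have Ce k b : eta k b \in C by have [] := Cue k b.
have Vrep x : klein_rep x - x \in V by rewrite memBC klein_rep_sub.
have rep_inj x x' a b a' b' : klein_rep x + klein_elt a b = klein_rep x' + klein_elt a' b' ->
    x - x' \in V /\ a = a' /\ b = b'.
  move=> eqxx'; have Vxx' : x - x' \in V.
    apply: (memB_trans (klein_rep_sub x)); apply: memB_trans (Vrep x').
    rewrite -[klein_rep x](addrK (klein_elt a b)) eqxx' [klein_rep x' + _]addrC addrAC addrK.
    by apply: memB; apply: klein_elt_in.
  by move: eqxx'; rewrite (klein_repP Vxx') => /addrI/klein_elt_inj.
pose X0 k b := klein_rep (u k b) + klein_elt false b.
pose Y0 k b := klein_rep (eta k b) + klein_elt (ceta k b) false.
pose S k b := klein_rep (u k b + eta k b) + klein_elt false (csum k b).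
have e_ kb : exists p : bool * bool, S kb.1 kb.2 - (X0 kb.1 kb.2 + Y0 kb.1 kb.2) = klein_elt p.1 p.2.
  case: kb => k b /=; suff /klein_eltP[p [p' ->]] : S k b - (X0 k b + Y0 k b) \in V by exists (p, p').
  rewrite /S /X0 /Y0 addrACA opprD addrACA.
  apply: memD; last by apply: memB; [exact: klein_elt_in | apply: memD; exact: klein_elt_in].
  apply: (memB_trans (Vrep _)); rewrite opprD addrACA.
  by apply: memD; apply: klein_rep_sub.
have [p pP] := fin_all_exists e_.
(* The defect [p] of additivity is split: its [w] part goes into [X] and its [z] part into [Y],
   which changes neither [X] modulo [w] nor [Y] modulo [z]. *)
pose X kb := X0 kb.1 kb.2 + klein_elt (p kb).1 false.
pose Y kb := Y0 kb.1 kb.2 + klein_elt false (p kb).2.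
have XY kb : X kb + Y kb = S kb.1 kb.2.
  by rewrite /X /Y addrACA klein_eltD addbF -pP addrC subrK.
have CV x : x \in V -> x \in C by apply: (subsetP sVC).
have Crep x : x \in C -> klein_rep x \in C.
  by move=> Cx; rewrite -(memDr (klein_rep x) (_ : - x \in C)) ?memN // CV.
apply: (@zero_sum_bij3_fin _ C (K0 * bool * bool)%type
  (fun t => X t.1 + klein_elt t.2 false) (fun t => Y t.1 + klein_elt false t.2)).
- by rewrite !card_prod card_bool -cardK; lia.
- move=> [[k b] e] [[k' b'] e'] /=; rewrite /X /X0 /= !addr_klein_eltD.
  case/rep_inj=> Vu [+ /= eqb]; rewrite ?addFb ?addbF in eqb; subst b'.
  by have {Vu} <- := uV _ _ _ Vu => /= /addbI->.
- move=> [[k b] e] [[k' b'] e'] /=; rewrite /Y /Y0 /= !addr_klein_eltD.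
  case/rep_inj=> Ve; rewrite ?addbF => -[eqc]; have [<- <-] := etaV _ _ _ _ Ve eqc.
  by rewrite ?addFb => /addbI->.
- move=> [[k b] e] [[k' b'] e'] /=; rewrite addrACA [RHS]addrACA !XY /S /= !klein_eltD !addr_klein_eltD.
  case/rep_inj=> Vs []; rewrite ?addbF ?addFb => eqe; rewrite {}eqe => /addIb eqc.
  by have [-> ->] := sumV _ _ _ _ Vs eqc.
- move=> [[k b] e] /=; apply: memD; last exact/CV/klein_elt_in.
  apply: memD; last exact/CV/klein_elt_in.
  by apply: memD; [apply: Crep | exact/CV/klein_elt_in].
- move=> [[k b] e] /=; apply: memD; last exact/CV/klein_elt_in.
  apply: memD; last exact/CV/klein_elt_in.
  by apply: memD; [apply: Crep | exact/CV/klein_elt_in].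
Qed.

End Klein.

(** * Arrays whose sides are odd primes *)

Section OddPrimes.
Variable G : finZmodType.
Implicit Types (C D H : {group G}) (p q : nat).

(** A subgroup of index [p] in the Sylow [p]-subgroup, joined with the [p']-part. *)
Lemma subgroup_prime_index H p :
  prime p -> (p %| #|H|)%N -> exists2 C : {group G}, C \subset H & #|H| = (#|C| * p)%N.
Proof.
move=> pr_p p_dv; have abH := zabelian H.
pose P := 'O_p(H)%G; pose O := 'O_(p^')(H)%G.
have hallP : (p.-Hall(H) P)%g by apply: nilpotent_pcore_Hall; rewrite abelian_nil.
have hallO : ((p^').-Hall(H) O)%g by apply: nilpotent_pcore_Hall; rewrite abelian_nil.
have cardP : #|P| = (p ^ logn p #|H|)%N by rewrite (card_Hall hallP) p_part.
have logp_gt0 : (0 < logn p #|H|)%N by rewrite logn_gt0 mem_primes pr_p cardG_gt0.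
have le_log : ((logn p #|H|).-1 <= logn p #|P|)%N by rewrite cardP pfactorK // leq_pred.
have [L [sLP _ cardL]] := normal_pgroup (pcore_pgroup p H : p.-group%g P) (normal_refl P) le_log.
have cop : coprime #|L| #|O|.
  apply: (@pnat_coprime p); last by rewrite (card_Hall hallO) part_pnat.
  by rewrite cardL pnatX pnat_id.
exists (L <*> O)%G.
  by rewrite join_subG pcore_sub (subset_trans sLP (pcore_sub _ _)).
rewrite /= norm_joinEr ?TI_cardMg ?coprime_TIg //; last first.
  by apply: cents_norm; apply/centsP=> x _ y _; apply: addrC.
rewrite cardL (card_Hall hallO) mulnAC -expnSr prednK // -p_part.
by rewrite partnC.
Qed.

Lemma prime_index_mul H D p x :
  D \subset H -> #|H| = (#|D| * p)%N -> x \in H -> x *+ p \in D.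
Proof.
move=> sDH cardH Hx; have := index_mul_mem sDH Hx.
suff -> : #|H : D|%g = p by [].
by apply/eqP; rewrite -(eqn_pmul2l (cardG_gt0 D)) Lagrange // cardH.
Qed.

Lemma mulrn_mem_prime D p x n :
  prime p -> x *+ p \in D -> x \notin D -> (x *+ n \in D) = (p %| n)%N.
Proof.
move=> pr_p Dxp Dx.
apply/idP/idP=> [Dxn|/dvdnP[m ->]]; last by rewrite mulnC mulrnA memMn.
apply: contraR Dx => p_n; have /coprimeP[|[u v] /= uv] : coprime n p.
- by rewrite coprime_sym prime_coprime.
- by rewrite lt0n; apply: contraNneq p_n => ->.
have : x *+ (u * n - v * p) \in D.
  by rewrite mulrnBr; [apply: memB; rewrite mulnC mulrnA memMn | lia].
by rewrite uv.
Qed.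

Lemma mulrnB_mem D x a b m :
  (forall n, x *+ n \in D -> (m %| n)%N) -> x *+ a - x *+ b \in D -> a = b %[mod m].
Proof.
move=> Dm; wlog leba : a b / (b <= a)%N => [wlg|].
  have [/wlg//|/ltnW/wlg h] := leqP b a.
  by rewrite memBC => /h.
by rewrite -mulrnBr // => /Dm; rewrite -eqn_mod_dvd // => /eqP.
Qed.

Lemma prime_index_proper D H p :
  prime p -> D \subset H -> #|H| = (#|D| * p)%N -> exists2 x, x \in H & x \notin D.
Proof.
move=> pr_p sDH cardH; apply/subsetPn; apply/negP=> /subset_leq_card.
by rewrite cardH -{2}(muln1 #|D|) leq_pmul2l ?cardG_gt0 // leqNgt prime_gt1.
Qed.

Lemma Fp_sum_mem C p o (I : finType) (a : I -> 'F_p) :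
  prime p -> o *+ p \in C -> \sum_i a i = 0 -> \sum_i o *+ a i \in C.
Proof.
move=> pr_p Cop suma; rewrite sumrMnr.
have /dvdnP[m ->] : (p %| \sum_i a i)%N; last by rewrite mulnC mulrnA memMn.
rewrite (dvdn_pcharf (pchar_Fp pr_p)) natr_sum.
by rewrite (eq_bigr a) ?suma // => i _; apply: natr_Zp.
Qed.

Lemma sum_ord_Fp p : prime p -> odd p -> \sum_(i < p) (i%:R : 'F_p) = 0.
Proof.
move=> pr_p oddp; apply/eqP; rewrite -natr_sum.
rewrite -(dvdn_pcharf (pchar_Fp pr_p)) -(big_mkord xpredT id) bin2_sum bin2odd //.
exact: dvdn_mulr.
Qed.

Lemma Fp_ord_inj p (i j : 'I_p) : prime p -> i%:R = j%:R :> 'F_p -> i = j.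
Proof.
move=> pr_p /(congr1 val); rewrite /= !val_Fp_nat ?modn_small //.
  by move/val_inj.
Qed.

(** In a row or a column both [i - j] and [i + j] run through all of ['F_p], and together they
    determine [(i, j)] because [p] is odd. Only transversals of [G / D] and [D / C] enter, so
    [G / C] may be cyclic or elementary. *)
Lemma tileable_pp p c :
    prime p -> odd p -> #|G| = (p * p * c)%N ->
    (forall C, #|G| = (#|C| * (p * p))%N -> zero_sum_bij3 C) ->
  tileable G p p c.
Proof.
move=> pr_p oddp cardG hp.
have [|D _ cardD] := @subgroup_prime_index [set: G]%G p pr_p.
  by rewrite cardsT cardG -mulnA dvdn_mulr.
have [|C sCD cardC] := @subgroup_prime_index D p pr_p.
  rewrite -(dvdn_pmul2r (prime_gt0 pr_p)) -cardD cardsT cardG dvdn_mulr //.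
rewrite cardsT in cardD.
have [|s [_ injs]] := @coset_reps G D [set: G]%G 'F_p (subsetT _).
  by rewrite cardsT cardD card_Fp.
have [|d [Dd injd]] := @coset_reps G C D 'F_p sCD; first by rewrite card_Fp.
pose F (k : unit) (i j : 'F_p) := s (i - j) + d (i + j).
pose gam := \sum_i s i + \sum_i d i.
have two_neq0 : 2%:R != 0 :> 'F_p.
  by rewrite -(dvdn_pcharf (pchar_Fp pr_p)) dvdn_prime2 //; apply: contraTneq oddp => ->.
have cardF : #|'F_p| = p := card_Fp pr_p.
have p1 := prime_gt1 pr_p; have p0 := prime_gt0 pr_p.
have tF : tiles xpredT gam gam (unit * 'I_#|C|)%type 'F_p 'F_p.
  apply: (@lift_tiles _ C _ _ _ _ _ F); rewrite ?cardF //.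
  - move=> [] i j [] i' j'; rewrite /F opprD addrACA => CF.
    have eqB : i - j = i' - j'.
      by apply: injs; move/(subsetP sCD): CF; rewrite (memDr _ (memB (Dd _) (Dd _))).
    move: CF; rewrite eqB subrr add0r => /injd eqD.
    have eqi : i = i'.
      apply: (mulfI two_neq0); rewrite !mulr_natl !mulr2n.
      by rewrite -[LHS](subrKA j) -[RHS](subrKA j') eqB; congr (_ + _); rewrite addrC eqD addrC.
    by split=> //; move: eqD; rewrite eqi => /addrI.
  - move=> k i; rewrite /F big_split /= /gam (reindex_inj (inj_comp (addrI i) oppr_inj)) /=.
    by rewrite [X in _ + X - _](reindex_inj (addrI i)) /= subrr mem0.
  - move=> k j; rewrite /F big_split /= /gam (reindex_inj (addIr (- j))) /=.
    by rewrite [X in _ + X - _](reindex_inj (addIr j)) /= subrr mem0.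
  - have := bij_table_ge2 (hp C _) p1 p1; rewrite cardD cardC -mulnA => /(_ erefl).
    by apply: bij_table_reindex; rewrite card_ord; apply: (esym (card_Fp pr_p)).
have := tileableP tF; rewrite cardF card_prod card_unit card_ord mul1n.
suff -> : #|C| = c by [].
apply/eqP; rewrite -(eqn_pmul2l p0) -(eqn_pmul2l p0) !mulnA -cardG cardD cardC; apply/eqP; lia.
Qed.

(** The sequence -2, 1, 1, -1, 1, -1, 1, ...: its first [q] terms sum to 0 for odd [q > 2], and no
    term vanishes where 2 is invertible. *)
Definition balanced_sign (R : pzRingType) (j : nat) : R :=
  if j is 0%N then - 2%:R else if (j < 3)%N then 1 else (-1) ^+ j.

Lemma sum_balanced_sign (R : pzRingType) q :
  odd q -> (2 < q)%N -> \sum_(j < q) balanced_sign R j = 0.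
Proof.
move=> oddq q2; have -> : q = ((q - 3)./2.*2 + 3)%N.
  by rewrite even_halfK ?subnK // oddB // oddq.
elim: (_./2) => [|k IHk].
  by rewrite !big_ord_recr big_ord0 /= add0r mulr2n -addrA addNr.
rewrite doubleS !addSn !big_ord_recr /= {}IHk add0r !addnS !addn0 /=.
by rewrite [X in _ + X]exprS mulN1r addrN.
Qed.

Lemma balanced_sign_neq0 (F : fieldType) j : 2%:R != 0 :> F -> balanced_sign F j != 0.
Proof.
case: j => [|j] two; first by rewrite oppr_eq0.
by rewrite /balanced_sign; case: ifP; rewrite ?oner_neq0 ?expf_neq0 ?oppr_eq0 ?oner_neq0.
Qed.

(** Each coordinate of [F_p x F_q] is a product of a function of [i] and a function of [j], both
    with sum zero. A cell is recovered in turn: [X] tells whether [i = 0], hence the value of [m i];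
    then [Y] gives [j], and [X] gives [i]. *)
Lemma tileable_pq p q c :
    prime p -> prime q -> odd p -> odd q -> (p < q)%N -> #|G| = (p * q * c)%N ->
    (forall C, #|G| = (#|C| * (p * q))%N -> zero_sum_bij3 C) ->
  tileable G p q c.
Proof.
move=> pr_p pr_q oddp oddq ltpq cardG hp.
have two_neq0 r : prime r -> odd r -> 2%:R != 0 :> 'F_r.
  by move=> pr_r oddr; rewrite -(dvdn_pcharf (pchar_Fp pr_r)) dvdn_prime2 //; apply: contraTneq oddr => ->.
have p1 := prime_gt1 pr_p; have p0 := prime_gt0 pr_p.
have q1 := prime_gt1 pr_q; have q0 := prime_gt0 pr_q.
have q_p1 : (1 - p%:R : 'F_q) != 0.
  have -> : 1 - p%:R = - (p - 1)%:R :> 'F_q by rewrite natrB // opprB.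
  rewrite oppr_eq0.
  rewrite -(dvdn_pcharf (pchar_Fp pr_q)); apply/negP=> /dvdn_leq; lia.
have [|D _ cardD] := @subgroup_prime_index [set: G]%G p pr_p.
  by rewrite cardsT cardG -mulnA dvdn_mulr.
rewrite cardsT in cardD.
have cardD' : #|D| = (q * c)%N by apply/eqP; rewrite -(eqn_pmul2r p0) -cardD cardG; lia.
have [|C sCD cardC] := @subgroup_prime_index D q pr_q; first by rewrite cardD' dvdn_mulr.
have cardC' : #|C| = c by apply/eqP; rewrite -(eqn_pmul2r q0) -cardC cardD' mulnC.
have [o2 Do2 Co2] := prime_index_proper pr_q sCD cardC.
have Co2q := prime_index_mul sCD cardC Do2.
have [|x _ Dx] := @prime_index_proper D [set: G]%G p pr_p (subsetT _); first by rewrite cardsT.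
have Dxp : x *+ p \in D by apply: (@prime_index_mul [set: G]%G); rewrite ?subsetT ?inE ?cardsT.
(* [x *+ p] is only known to lie in [D]; the factor [q] sends [D] into [C], and being prime to [p]
   it keeps [o1] outside [D]. *)
pose o1 := x *+ q.
have Co1p : o1 *+ p \in C by rewrite /o1 -mulrnA mulnC mulrnA (prime_index_mul sCD).
have Do1 n : o1 *+ n \in D -> (p %| n)%N.
  rewrite /o1 -mulrnA (mulrn_mem_prime _ pr_p Dxp Dx) Euclid_dvdM // => /orP[|//].
  by rewrite dvdn_prime2 // => /eqP eqpq; rewrite eqpq ltnn in ltpq.
have Co2n n : o2 *+ n \in C -> (q %| n)%N by rewrite (mulrn_mem_prime _ pr_q Co2q Co2).
pose X (i : 'I_p) (j : 'I_q) : 'F_p := balanced_sign _ j * i%:R.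
(* One multiplier [1 - p] balances the [p - 1] ones; it is nonzero in ['F_q] because [p < q]. *)
pose m (i : 'I_p) : 'F_q := if i == 0%N :> nat then 1 - p%:R else 1.
pose Y (i : 'I_p) (j : 'I_q) : 'F_q := m i * j%:R.
pose F (k : unit) i j := o1 *+ X i j + o2 *+ Y i j.
have m_neq0 i : m i != 0 by rewrite /m; case: ifP; rewrite // oner_neq0.
have sum_m : \sum_i m i = 0.
  rewrite (bigD1 (Ordinal p0)) //= (eq_bigr (fun => 1)) => [|i /negPf i0]; last first.
    by rewrite /m (_ : (i == 0%N :> nat) = false).
  by rewrite /m /= sumr_const cardC1 card_ord -{1}(prednK p0) -natr1 opprD addrCA subrr addr0 addNr.
have bal_neq0 j : balanced_sign 'F_p j != 0 by rewrite balanced_sign_neq0 ?two_neq0.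
have valF r (a b : 'F_r) : prime r -> a = b %[mod r] -> a = b.
  move=> pr_r eqab; rewrite -[a]natr_Zp -[b]natr_Zp; apply/val_inj.
  by rewrite /= !val_Fp_nat.
have tF : tiles (xpredT : pred G) 0 0 (unit * 'I_#|C|)%type 'I_p 'I_q.
  apply: (@lift_tiles _ C _ _ _ _ _ F); rewrite ?card_ord ?mul0rn //.
  - move=> [] i j [] i' j'; rewrite /F opprD addrACA => CF.
    have eqX : X i j = X i' j'.
      apply: valF => //; apply: (mulrnB_mem Do1).
      by move/(subsetP sCD): CF; rewrite (memDr _ (memB (memMn _ Do2) (memMn _ Do2))).
    have eqY : Y i j = Y i' j'.
      apply: valF => //; apply: (mulrnB_mem Co2n).
      by move: CF; rewrite eqX subrr add0r.
    have i0P (i1 : 'I_p) j1 : (X i1 j1 == 0) = (i1 == 0%N :> nat).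
      rewrite mulf_eq0 (negPf (bal_neq0 _)) -(dvdn_pcharf (pchar_Fp pr_p)) /=.
      by rewrite /dvdn modn_small.
    have eqm : m i = m i' by rewrite /m -(i0P i j) eqX i0P.
    have eqj : j = j'.
      by apply: (Fp_ord_inj pr_q); apply: (mulfI (m_neq0 i)); rewrite {2}eqm.
    split=> //; apply: (Fp_ord_inj pr_p); apply: (mulfI (bal_neq0 j)).
    by rewrite {2}eqj.
  - move=> k i; rewrite sub0r memN big_split memD //; apply: Fp_sum_mem => //=.
      by rewrite -mulr_suml sum_balanced_sign ?mul0r // odd_prime_gt2.
    by rewrite -mulr_sumr sum_ord_Fp // mulr0.
  - move=> k j; rewrite sub0r memN big_split memD //; apply: Fp_sum_mem => //=.
      by rewrite -mulr_sumr sum_ord_Fp // mulr0.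
    by rewrite -mulr_suml sum_m mul0r.
  - by apply: bij_table_ge2 => //; apply: hp; rewrite cardD cardC -mulnA (mulnC q).
by have := tileableP tF; rewrite card_prod card_unit !card_ord mul1n cardC'.
Qed.

Lemma tileable_odd_primes p q c :
    prime p -> prime q -> odd p -> odd q -> #|G| = (p * q * c)%N ->
    (forall C, #|G| = (#|C| * (p * q))%N -> zero_sum_bij3 C) ->
  tileable G p q c.
Proof.
move=> pr_p pr_q oddp oddq cardG hp; have [ltpq|ltqp|eqpq] := ltngtP p q; last subst q.
- exact: tileable_pq.
- by rewrite (mulnC p) in cardG hp; apply/tileable_tr/tileable_pq.
- exact: tileable_pp.
Qed.

End OddPrimes.

(** * Arrays with four columns *)

Section Transfer.
Variable G : finZmodType.
Implicit Types C : {group G}.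

(** A form of additivity modulo [C] that suits maps such as [o *+ a], defined through the numerical
    representative of [a]. *)
Definition sum0_mod (U : zmodType) C (psi : U -> G) : Prop :=
  forall (I : finType) (a : I -> U), \sum_i a i = 0 -> \sum_i psi (a i) \in C.

Lemma sum0_mod_pair (U1 U2 : zmodType) C (psi1 : U1 -> G) (psi2 : U2 -> G) :
  sum0_mod C psi1 -> sum0_mod C psi2 -> sum0_mod C (fun u : U1 * U2 => psi1 u.1 + psi2 u.2).
Proof.
move=> h1 h2 I a a0; rewrite big_split; apply: memD.
  by apply: h1; rewrite -(raddf_sum fst) a0.
by apply: h2; rewrite -(raddf_sum snd) a0.
Qed.

Lemma sum0_mod_Zp N C o : (1 < N)%N -> o *+ N \in C -> sum0_mod C (fun a : 'Z_N => o *+ a).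
Proof.
move=> N1 CoN I a a0; rewrite sumrMnr.
have /dvdnP[m ->] : (N %| \sum_i a i)%N; last by rewrite mulnC mulrnA memMn.
apply/eqP; rewrite -(val_Zp_nat N1) natr_sum.
by rewrite (eq_bigr a) ?a0 // => i _; apply: natr_Zp.
Qed.

Lemma sum0_mod_Fp p C o : prime p -> o *+ p \in C -> sum0_mod C (fun a : 'F_p => o *+ a).
Proof. by move=> pr_p Cop I a; apply: Fp_sum_mem. Qed.

Lemma transfer_tiles (U : zmodType) (S : pred U) C (psi : U -> G) (K I J : finType) :
    sum0_mod C psi -> (forall u v, psi u - psi v \in C -> u = v) ->
    tiles S 0 0 K I J -> (0 < #|I|)%N -> (0 < #|J|)%N -> bij_table C I J ->
  tiles (xpredT : pred G) 0 0 (K * 'I_#|C|)%type I J.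
Proof.
move=> psi0 injpsi [F [injF _ rowF colF]] I0 J0 btab.
apply: (@lift_tiles _ C _ _ _ _ _ (fun k i j => psi (F k i j))); rewrite ?mul0rn //.
- by move=> k i j k' i' j' /injpsi/injF.
- by move=> k i; rewrite sub0r memN psi0.
- by move=> k j; rewrite sub0r memN psi0.
Qed.

End Transfer.

Section Tables.

Lemma sum_ord4 (U : zmodType) (f : 'I_4 -> U) :
  \sum_j f j = f 0 + f 1 + f 2%:R + f 3%:R.
Proof.
rewrite !big_ord_recr big_ord0 /= add0r.
by congr (_ + _ + _ + _); congr (f _); apply: val_inj.
Qed.

Lemma big_foldr (U : zmodType) (I : Type) (s : seq I) (f : I -> U) :
  \sum_(i <- s) f i = foldr (fun i => +%R (f i)) 0 s.
Proof. by elim: s => [|i s IHs]; rewrite ?big_nil // big_cons IHs. Qed.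

Lemma big_ord_foldr (U : zmodType) n (f : nat -> U) :
  \sum_(i < n) f i = foldr (fun i => +%R (f i)) 0 (iota 0 n).
Proof. by rewrite -big_foldr -(big_mkord xpredT f) /index_iota subn0. Qed.

Definition table_entry (U : zmodType) (t : seq (seq (seq U))) k i j : U :=
  nth 0 (nth [::] (nth [::] t k) i) j.

(** Lists and [foldr] replace ordinals and big operators so that the test can be evaluated. *)
Definition table_ok (U : zmodType) c a b (t : seq (seq (seq U))) : bool :=
  let f := table_entry t in
  let cells := allpairs (fun x y => (x, y)) (allpairs (fun x y => (x, y)) (iota 0 c) (iota 0 a)) (iota 0 b) in
  [&& all (fun x => all (fun y => (f x.1.1 x.1.2 x.2 == f y.1.1 y.1.2 y.2) ==> (x == y)) cells) cells,
      all (fun k => all (fun i => foldr (fun j => +%R (f k i j)) 0 (iota 0 b) == 0) (iota 0 a)) (iota 0 c)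
    & all (fun k => all (fun j => foldr (fun i => +%R (f k i j)) 0 (iota 0 a) == 0) (iota 0 b)) (iota 0 c)].

Lemma table_okP (U : zmodType) c a b (t : seq (seq (seq U))) :
  table_ok c a b t -> let F (k : 'I_c) (i : 'I_a) (j : 'I_b) := table_entry t k i j in
  [/\ inj3 F, forall k i, \sum_j F k i j = 0 & forall k j, \sum_i F k i j = 0].
Proof.
have mem_ord n (i : 'I_n) : (i : nat) \in iota 0 n by rewrite mem_iota add0n ltn_ord.
case/and3P=> /allP injt /allP rowt /allP colt F; split.
- move=> k i j k' i' j' eqF.
  have in_cells (k1 : 'I_c) (i1 : 'I_a) (j1 : 'I_b) : (k1 : nat, i1 : nat, j1 : nat) \in
      allpairs (fun x y => (x, y)) (allpairs (fun x y => (x, y)) (iota 0 c) (iota 0 a)) (iota 0 b).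
    by apply: allpairs_f => //; apply: allpairs_f.
  have /allP/(_ _ (in_cells k' i' j'))/implyP/= := injt _ (in_cells k i j).
  by move/(_ (introT eqP eqF))/eqP=> [/val_inj-> /val_inj-> /val_inj->].
- move=> k i; rewrite (big_ord_foldr b (table_entry t k i)).
  by have /allP/(_ _ (mem_ord _ i))/eqP := rowt _ (mem_ord _ k).
- move=> k j; rewrite (big_ord_foldr a (fun i => table_entry t k i j)).
  by have /allP/(_ _ (mem_ord _ j))/eqP := colt _ (mem_ord _ k).
Qed.

Lemma table_entry_all (U : zmodType) (t : seq (seq (seq U))) (P : pred U) k i j :
  P 0 -> all (all (all P)) t -> P (table_entry t k i j).
Proof.
move=> P0 allP; rewrite /table_entry.
have [ltk|lek] := ltnP k (size t); last by rewrite (nth_default [::] lek) !nth_nil.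
have {}allP := all_nthP [::] allP k ltk.
have [lti|lei] := ltnP i (size (nth [::] t k)); last by rewrite (nth_default [::] lei) nth_nil.
have {}allP := all_nthP [::] allP i lti.
have [ltj|lej] := ltnP j (size (nth [::] (nth [::] t k) i)); last by rewrite nth_default.
exact: all_nthP allP j ltj.
Qed.

End Tables.

Section Labels.
Variables (T : zmodType) (p : nat).
Hypothesis pr_p : prime p.

Lemma intr_Fp_inj (l l' : int) h :
  (2 * h < p)%N -> (`|l| <= h)%N -> (`|l'| <= h)%N -> l%:~R = l'%:~R :> 'F_p -> l = l'.
Proof.
move=> hp lh l'h /eqP; rewrite -subr_eq0 -intrB => /eqP eq0; apply/eqP; rewrite -subr_eq0.
have : (p %| `|l - l'|)%N.
  rewrite (dvdn_pcharf (pchar_Fp pr_p)); move: eq0; case: (l - l') => n //=.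
    by rewrite -pmulrn => ->.
  by rewrite NegzE mulrNz -pmulrn => /eqP; rewrite oppr_eq0.
by rewrite -absz_eq0; apply: contraTT => nz; apply/negP=> /dvdn_leq; lia.
Qed.

Definition cylinder (S : pred T) : pred (T * 'F_p)%type := fun u => S u.1.

(* The rows of X are completed by pairs of rows carrying the labels (l, l, -l, -l) and (-l, -l, l, l), for each label l beyond those of the core F. *)
Lemma label_tiles (S : pred T) c h m (F : 'I_c -> 'I_(2 * h).+1 -> 'I_4 -> T * int)
    (X : 'I_c -> 'I_4 -> T) :
    p = (2 * (h + m)).+1 -> (forall x, S (- x) = S x) ->
    inj3 F -> (forall k i j, S (F k i j).1) -> (forall k i j, `|(F k i j).2| <= h)%N ->
    (forall k i, \sum_j F k i j = 0) -> (forall k j, \sum_i F k i j = 0) ->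
    (forall k j k' j', X k j = X k' j' -> k = k' /\ j = j') -> (forall k j, S (X k j)) ->
    (forall k, X k 0 + X k 1 = X k 2%:R + X k 3%:R) ->
  tiles (cylinder S) 0 0 'I_c 'I_p 'I_4.
Proof.
move=> defp symS injF FS Fh rowF colF injX XS XX.
pose sgj (j : 'I_4) := (1 < j)%N.
pose F' (k : 'I_c) (i : 'I_(2 * h).+1 + 'I_m * bool) (j : 'I_4) : T * int :=
  match i with
  | inl i => F k i j
  | inr (t, b) => if b (+) sgj j then (X k j, (h + t).+1%:Z) else (- X k j, - (h + t).+1%:Z)
  end.
have F'b k i j : (`|(F' k i j).2| <= h + m)%N.
  case: i => [i|[t b]] /=; first by apply: leq_trans (Fh _ _ _) (leq_addr _ _).
  by case: ifP => _ /=; have := ltn_ord t; lia.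
have Fnew k i j k' t b j' : F k i j <> F' k' (inr (t, b)) j'.
  by move=> eqF; have := Fh k i j; rewrite eqF /=; case: ifP => _ /=; lia.
have injF' : inj3 F'.
  move=> k [i|[t b]] j k' [i'|[t' b']] j'.
  - by case/injF=> -> -> ->.
  - by move/Fnew.
  - by move/esym/Fnew.
  - rewrite /=; case: ifP => bj; case: ifP => bj' [].
    + move=> /injX[-> eqj] eqt; split=> //; congr (inr (_, _)); first by apply: val_inj => /=; lia.
      by move: bj bj'; rewrite eqj; case: (b) (b') (sgj j') => [] [] [].
    + by lia.
    + by lia.
    + move=> /oppr_inj/injX[-> eqj] eqt; split=> //; congr (inr (_, _)).
        by apply: val_inj => /=; lia.
      by move: bj bj'; rewrite eqj; case: (b) (b') (sgj j') => [] [] [].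
have rowF' k i : \sum_j F' k i j = 0.
  case: i => [i|[t b]]; first exact: rowF.
  have /eqP := XX k; rewrite -subr_eq0 opprD addrA => /eqP XXk.
  rewrite sum_ord4; case: b; last first.
    rewrite [LHS](_ : _ = (- X k 0 - X k 1 + X k 2%:R + X k 3%:R,
      - (h + t).+1%:Z - (h + t).+1%:Z + (h + t).+1%:Z + (h + t).+1%:Z)) //.
    by congr pair; [apply/eqP; rewrite -oppr_eq0 !opprD !opprK XXk | lia].
  rewrite [LHS](_ : _ = (X k 0 + X k 1 - X k 2%:R - X k 3%:R,
    (h + t).+1%:Z + (h + t).+1%:Z - (h + t).+1%:Z - (h + t).+1%:Z)) //.
  by congr pair; [rewrite XXk | lia].
have colF' k j : \sum_i F' k i j = 0.
  rewrite big_sumType; apply: etrans (congr2 _ (colF k j) _) (add0r 0).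
  transitivity (\sum_t \sum_b F' k (inr (t, b)) j).
    by rewrite pair_bigA; apply: eq_bigr => -[].
  rewrite big1 // => t _; rewrite big_bool /=.
  by case: (sgj j) => /=; apply/pair_equal_spec; rewrite /= ?addrN ?addNr.
have cardI : #|('I_(2 * h).+1 + 'I_m * bool : finType)%type| = #|'I_p|.
  by rewrite card_sum card_prod card_bool !card_ord defp; lia.
apply: (tiles_reindex erefl cardI erefl).
exists (fun k i j => ((F' k i j).1, (F' k i j).2%:~R)); split.
- move=> k i j k' i' j' [eq1 eq2]; apply: injF'.
  rewrite [LHS]surjective_pairing [RHS]surjective_pairing eq1; congr pair.
  by apply: (intr_Fp_inj _ _ _ eq2 (h := h + m)); rewrite ?F'b // defp.
- move=> k [i|[t b]] j; rewrite /cylinder /= ?FS //.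
  by case: ifP; rewrite /= ?symS XS.
- move=> k i; apply: injective_projections; rewrite raddf_sum /=.
    by rewrite -(raddf_sum fst) rowF'.
  by rewrite -(rmorph_sum intr) /= -(raddf_sum snd) rowF' mulr0z.
- move=> k j; apply: injective_projections; rewrite raddf_sum /=.
    by rewrite -(raddf_sum fst) colF'.
  by rewrite -(rmorph_sum intr) /= -(raddf_sum snd) colF' mulr0z.
Qed.

End Labels.

(* The explicit arrays below were found by a computer search; a cell (t, l) stands for the element t of the 2-part carrying the label l, to be read modulo p. *)

Definition klein_table3 : seq (seq (seq ('Z_2 * 'Z_2 * 'F_3))) :=
  [:: [:: [:: ((0, 0), 0); ((0, 1), 1); ((1, 0), 0); ((1, 1), - 1)];
     [:: ((1, 0), - 1); ((0, 0), - 1); ((0, 1), - 1); ((1, 1), 0)];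
     [:: ((1, 0), 1); ((0, 1), 0); ((1, 1), 1); ((0, 0), 1)]]].

Definition klein_table5 : seq (seq (seq ('Z_2 * 'Z_2 * int))) :=
  [:: [:: [:: ((0, 0), - 2); ((0, 0), - 1); ((0, 1), 1); ((0, 1), 2)];
     [:: ((0, 0), 1); ((0, 0), 0); ((1, 0), 0); ((1, 0), - 1)];
     [:: ((1, 1), - 1); ((0, 0), 2); ((1, 0), 1); ((0, 1), - 2)];
     [:: ((1, 0), 2); ((1, 1), - 2); ((1, 0), - 2); ((1, 1), 2)];
     [:: ((0, 1), 0); ((1, 1), 1); ((1, 1), 0); ((0, 1), - 1)]]].

Definition Z24_table : seq (seq (seq ('Z_2 * 'Z_4 * int))) :=
  [:: [:: [:: ((0, 0), 1); ((0, 0), - 1); ((0, 1), 0); ((0, 3), 0)];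
     [:: ((1, 1), 0); ((0, 2), 0); ((0, 1), 1); ((1, 0), - 1)];
     [:: ((1, 3), - 1); ((0, 2), 1); ((0, 2), - 1); ((1, 1), 1)]];
    [:: [:: ((0, 0), 0); ((0, 1), - 1); ((1, 0), 0); ((1, 3), 1)];
     [:: ((1, 2), - 1); ((1, 0), 1); ((0, 3), 1); ((0, 3), - 1)];
     [:: ((1, 2), 1); ((1, 3), 0); ((1, 1), - 1); ((1, 2), 0)]]].

Definition Z222_table3 : seq (seq (seq ('Z_2 * 'Z_2 * 'Z_2 * 'F_3))) :=
  [:: [:: [:: ((0, 0, 0), 1); ((0, 0, 1), 0); ((0, 1, 0), 0); ((0, 1, 1), - 1)];
     [:: ((1, 0, 0), 0); ((1, 0, 1), - 1); ((0, 0, 0), - 1); ((0, 0, 1), - 1)];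
     [:: ((1, 0, 0), - 1); ((1, 0, 0), 1); ((0, 1, 0), 1); ((0, 1, 0), - 1)]];
    [:: [:: ((0, 0, 0), 0); ((0, 1, 1), 0); ((1, 0, 1), 1); ((1, 1, 0), - 1)];
     [:: ((1, 1, 1), 1); ((1, 0, 1), 0); ((0, 1, 1), 1); ((0, 0, 1), 1)];
     [:: ((1, 1, 1), - 1); ((1, 1, 0), 0); ((1, 1, 0), 1); ((1, 1, 1), 0)]]].

Definition Z222_table5 : seq (seq (seq ('Z_2 * 'Z_2 * 'Z_2 * int))) :=
  [:: [:: [:: ((0, 0, 0), - 2); ((0, 0, 1), 1); ((1, 1, 0), - 1); ((1, 1, 1), 2)];
     [:: ((0, 1, 0), - 1); ((0, 0, 0), 1); ((1, 0, 1), 1); ((1, 1, 1), - 1)];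
     [:: ((1, 1, 0), 1); ((0, 0, 0), 0); ((0, 0, 1), - 2); ((1, 1, 1), 1)];
     [:: ((1, 1, 0), 2); ((1, 1, 0), - 2); ((1, 0, 0), 2); ((1, 0, 0), - 2)];
     [:: ((0, 1, 0), 0); ((1, 1, 1), 0); ((1, 1, 0), 0); ((0, 1, 1), 0)]];
    [:: [:: ((0, 0, 0), 2); ((0, 0, 1), - 1); ((0, 1, 0), 1); ((0, 1, 1), - 2)];
     [:: ((0, 1, 1), - 1); ((0, 1, 1), 1); ((0, 1, 0), - 2); ((0, 1, 0), 2)];
     [:: ((1, 0, 1), - 1); ((1, 0, 0), 0); ((1, 0, 1), 2); ((1, 0, 0), - 1)];
     [:: ((0, 1, 1), 2); ((1, 1, 1), - 2); ((0, 0, 0), - 1); ((1, 0, 0), 1)];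
     [:: ((1, 0, 1), - 2); ((0, 0, 1), 2); ((1, 0, 1), 0); ((0, 0, 1), 0)]]].

Lemma klein_table3_ok : table_ok 1 3 4 klein_table3.
Proof. by vm_compute. Qed.
Lemma klein_table5_ok : table_ok 1 5 4 klein_table5.
Proof. by vm_compute. Qed.
Lemma Z24_table_ok : table_ok 2 3 4 Z24_table.
Proof. by vm_compute. Qed.
Lemma Z222_table3_ok : table_ok 2 3 4 Z222_table3.
Proof. by vm_compute. Qed.
Lemma Z222_table5_ok : table_ok 2 5 4 Z222_table5.
Proof. by vm_compute. Qed.

(** The test for the family [X] of [label_tiles]. *)
Definition quads_ok (U : zmodType) c (x : seq (seq U)) : bool :=
  let f k j := nth 0 (nth [::] x k) j in
  let cells := allpairs (fun k j => (k, j)) (iota 0 c) (iota 0 4) in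
  all (fun u => all (fun v => (f u.1 u.2 == f v.1 v.2) ==> (u == v)) cells) cells
  && all (fun k => f k 0%N + f k 1%N == f k 2%N + f k 3%N) (iota 0 c).

Lemma table_tiles (T : zmodType) p c h (t : seq (seq (seq (T * int)))) (x : seq (seq T)) :
    prime p -> odd p -> (2 * h < p)%N -> table_ok c (2 * h).+1 4 t ->
    all (all (all (fun u => `|u.2| <= h)%N)) t -> quads_ok c x ->
  tiles (@cylinder T p xpredT) 0 0 'I_c 'I_p 'I_4.
Proof.
move=> pr_p oddp ltp /table_okP[injt rowt colt] boundt /andP[/allP injx /allP sumx].
have defp : p = (2 * (h + (p - (2 * h).+1)./2)).+1.
  have : odd (p - (2 * h).+1) = false by rewrite oddB //= mul2n odd_double oddp.
  lia.
have mem_ord n (i : 'I_n) : (i : nat) \in iota 0 n by rewrite mem_iota add0n ltn_ord.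
apply: (@label_tiles T p pr_p xpredT c h _ _
  (fun (k : 'I_c) (j : 'I_4) => nth 0 (nth [::] x k) j) defp _ injt _ _ rowt colt) => //.
- by move=> k i j; apply: (table_entry_all (P := fun u => (`|u.2| <= h)%N) _ _ _ _ boundt).
- move=> k j k' j' eqx.
  have in_cells (k1 : 'I_c) (j1 : 'I_4) : (k1 : nat, j1 : nat) \in
      allpairs (fun k j => (k, j)) (iota 0 c) (iota 0 4) by apply: allpairs_f.
  have /allP/(_ _ (in_cells k' j'))/implyP/= := injx _ (in_cells k j).
  by move/(_ (introT eqP eqx))/eqP=> [/val_inj-> /val_inj->].
- by move=> k; apply/eqP/(sumx k).
Qed.

Lemma table3_tiles (T : zmodType) c (t : seq (seq (seq (T * 'F_3)))) :
  table_ok c 3 4 t -> tiles (@cylinder T 3 xpredT) 0 0 'I_c 'I_3 'I_4.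
Proof.
case/table_okP=> injt rowt colt.
by exists (fun (k : 'I_c) (i : 'I_3) (j : 'I_4) => table_entry t k i j).
Qed.

(** The prime 3 is apart because some rows of [klein_table3] and [Z222_table3] have label sum 3 or
    -3, zero only modulo 3, so these tables cannot be cores for larger primes. [Z24_table] has
    integer label sums 0 and serves every odd prime. *)
Lemma odd_prime_cases p : prime p -> odd p -> p = 3 \/ (2 * 2 < p)%N.
Proof. by case: p => [|[|[|[|[|p]]]]] // _ _; [left | right]. Qed.

Lemma klein_tiles p : prime p -> odd p ->
  tiles (@cylinder ('Z_2 * 'Z_2)%type p xpredT) 0 0 'I_1 'I_p 'I_4.
Proof.
move=> pr_p oddp; have [-> | p5] := odd_prime_cases pr_p oddp.
  exact: table3_tiles klein_table3_ok.
apply: (table_tiles (h := 2) pr_p oddp p5 klein_table5_ok); first by vm_compute.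
by instantiate (1 := [:: [:: (0, 0); (1, 0); (0, 1); (1, 1)]]); vm_compute.
Qed.

Lemma Z24_tiles p : prime p -> odd p ->
  tiles (@cylinder ('Z_2 * 'Z_4)%type p xpredT) 0 0 'I_2 'I_p 'I_4.
Proof.
move=> pr_p oddp; have p3 := odd_prime_gt2 oddp pr_p.
apply: (table_tiles (h := 1) (x := [:: [:: (0, 0); (1, 0); (0, 2); (1, 2)];
  [:: (0, 1); (1, 1); (0, 3); (1, 3)]]) pr_p oddp p3 Z24_table_ok); by vm_compute.
Qed.

Lemma Z222_tiles p : prime p -> odd p ->
  tiles (@cylinder ('Z_2 * 'Z_2 * 'Z_2)%type p xpredT) 0 0 'I_2 'I_p 'I_4.
Proof.
move=> pr_p oddp; have [-> | p5] := odd_prime_cases pr_p oddp.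
  exact: table3_tiles Z222_table3_ok.
apply: (table_tiles (h := 2) (x := [:: [:: (0, 0, 0); (1, 0, 0); (0, 1, 0); (1, 1, 0)];
  [:: (0, 0, 1); (1, 0, 1); (0, 1, 1); (1, 1, 1)]]) pr_p oddp p5 Z222_table5_ok); by vm_compute.
Qed.

(* The three bijections of T are x, y and -(x + y), with labels 0, 1 and -1. *)
Lemma pattern_tiles (T : zmodType) p (S : pred T) c (x y : 'I_c -> 'I_4 -> T) :
    prime p -> odd p -> (forall u, S (- u) = S u) ->
    (forall k j k' j', x k j = x k' j' -> k = k' /\ j = j') ->
    (forall k j k' j', y k j = y k' j' -> k = k' /\ j = j') ->
    (forall k j k' j', x k j + y k j = x k' j' + y k' j' -> k = k' /\ j = j') ->
    (forall k j, [&& S (x k j), S (y k j) & S (x k j + y k j)]) ->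
    (forall k, x k 0 + x k 1 = 0) -> (forall k, x k 2%:R + x k 3%:R = 0) ->
    (forall k, y k 0 + y k 1 = y k 2%:R + y k 3%:R) ->
  tiles (@cylinder T p S) 0 0 'I_c 'I_p 'I_4.
Proof.
move=> pr_p oddp symS injx injy injxy Sxy x01 x23 yy.
have Sx k j : S (x k j) by case/and3P: (Sxy k j).
have Sy k j : S (y k j) by case/and3P: (Sxy k j).
have Sz k j : S (x k j + y k j) by case/and3P: (Sxy k j).
pose z k j := - (x k j + y k j).
(* Row 0 is [x], row 1 is [(y, y, z, z)] and row 2 is [(z, z, y, y)]. Columns cancel as
   [x + y + z = 0]; rows cancel by the relations on pairs of columns. *)
pose F (k : 'I_c) (i : 'I_(2 * 1).+1) (j : 'I_4) : T * int :=
  if i == 0%N :> nat then (x k j, 0)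
  else if (i == 1%N :> nat) == (j < 2)%N then (y k j, 1) else (z k j, - 1).
have p3 := odd_prime_gt2 oddp pr_p.
have defp : p = (2 * (1 + (p - (2 * 1).+1)./2)).+1.
  have : odd (p - (2 * 1).+1) = false by rewrite oddB //= oddp.
  lia.
apply: (@label_tiles T p pr_p S c 1 _ F x defp symS _ _ _ _ _ injx Sx).
- move=> k i j k' i' j'; rewrite /F.
  have eqi (h : (i == 0%N :> nat) = false) (h' : (i' == 0%N :> nat) = false) :
    (i == 1%N :> nat) = (i' == 1%N :> nat) -> i = i'.
    by move=> e; apply: val_inj => /=; have := ltn_ord i; have := ltn_ord i'; lia.
  case i0: (i == 0%N :> nat); case i0': (i' == 0%N :> nat).
  + by case=> /injx[-> ->]; split=> //; apply: val_inj; rewrite /= (eqP i0) (eqP i0').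
  + by case: ifP => _ /(congr1 (fun u => absz u.2)).
  + by case: ifP => _ /(congr1 (fun u => absz u.2)).
  + case: ifP => e; case: ifP => e'; [move/(congr1 fst) => /= | by move/(congr1 (fun u => sgz u.2)) | by move/(congr1 (fun u => sgz u.2)) | move/(congr1 fst) => /=].
      by move=> /injy[-> eqj]; split=> //; apply: eqi => //; move: e e'; rewrite eqj => /eqP-> /eqP->.
    move=> /oppr_inj/injxy[-> eqj]; split=> //; apply: eqi => //; move: e e'; rewrite eqj.
    by case: (i == 1%N :> nat); case: (i' == 1%N :> nat); case: (j' < 2)%N.
- by move=> k i j; rewrite /F; case: ifP => _; [|case: ifP => _]; rewrite //= /z symS.
- by move=> k i j; rewrite /F; case: ifP => _; [|case: ifP => _].
- move=> k i; rewrite sum_ord4 /F.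
  have zz j j' : x k j + x k j' = 0 -> z k j + z k j' = - (y k j + y k j').
    by rewrite /z -opprD addrACA => ->; rewrite add0r.
  case: i => -[|[|[|//]]] lti /=; apply: injective_projections; rewrite //=.
  + by rewrite x01 add0r x23.
  + by rewrite -addrA zz // yy subrr.
  + by rewrite zz // -addrA yy addNr.
- move=> k j; rewrite !big_ord_recl big_ord0 /F /=.
  by case: (j < 2)%N; apply: injective_projections; rewrite //= /z addr0 ?[- _ + _]addrC addrA subrr.
- by move=> k; rewrite x01 x23.
Qed.

(** * The group Z/2 x Z/8m off its Klein subgroup *)

Section Rest.
Variable m : nat.
Hypothesis m_gt0 : (0 < m)%N.

(* rest_perm permutes the nonzero residues n modulo 8m other than 4m in such a way that n + rest_perm n mod 4m takes every nonzero value exactly twice; rest_color separates the two preimages. *)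
Definition rest_perm (n : nat) : nat :=
  if (n < 4 * m)%N then (if n == (2 * m)%N then (4 * m).+1 else n)
  else if n == (4 * m).+1 then (2 * m)%N
  else if (n <= 6 * m)%N then (n + 2 * m - 1)%N else (n + 1 - 2 * m)%N.

Definition rest_color (n : nat) : bool :=
  ((2 * m <= n) && (n < 4 * m))%N || (6 * m < n)%N.

(** The residue of [n + rest_perm n] modulo [4 * m], in closed form so that injectivity on each
    colour is linear arithmetic. Residues below [4 * m] other than [2 * m] give the even sums. At
    [2 * m] the identity would give sum 0, hence its exchange with [4 * m + 1]; it joins the
    residues above [4 * m] in giving the odd sums. *)
Definition rest_sum (n : nat) : nat :=
  if (n < 2 * m)%N then (2 * n)%N
  else if n == (2 * m)%N then (2 * m).+1
  else if (n < 4 * m)%N then (2 * n - 4 * m)%N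
  else let q := (n - 4 * m)%N in
  if (q <= 2 * m)%N then (if (2 * q <= 2 * m)%N then (2 * q + 2 * m - 1)%N else (2 * q - 1 - 2 * m)%N)
  else if (2 * q + 1 < 6 * m)%N then (2 * q + 1 - 2 * m)%N else (2 * q + 1 - 6 * m)%N.

Definition rest_dom (n : nat) : bool := [&& (0 < n)%N, (n < 8 * m)%N & n != (4 * m)%N].

Lemma rest_perm_dom n : rest_dom n -> rest_dom (rest_perm n).
Proof. by rewrite /rest_dom /rest_perm => /and3P[]; do !case: ifP; lia. Qed.

Lemma rest_perm_inj n n' : rest_dom n -> rest_dom n' -> rest_perm n = rest_perm n' -> n = n'.
Proof. by rewrite /rest_dom /rest_perm => /and3P[? ? ?] /and3P[? ? ?]; do !case: ifP; lia. Qed.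

Lemma rest_sum_bounds n : rest_dom n -> (0 < rest_sum n < 4 * m)%N.
Proof. by rewrite /rest_dom /rest_sum => /and3P[]; do !case: ifP; lia. Qed.

Lemma rest_sum_inj n n' : rest_dom n -> rest_dom n' ->
  rest_color n = rest_color n' -> rest_sum n = rest_sum n' -> n = n'.
Proof.
rewrite /rest_dom /rest_color /rest_sum => /and3P[? ? ?] /and3P[? ? ?].
by do !case: ifP; lia.
Qed.

Lemma rest_sumE n : rest_dom n -> n + rest_perm n = rest_sum n %[mod 4 * m].
Proof.
move=> dn; suff [c ->] : exists c, (n + rest_perm n = c * (4 * m) + rest_sum n)%N by rewrite modnMDl.
suff : [|| n + rest_perm n == rest_sum n, n + rest_perm n == 1 * (4 * m) + rest_sum n,
  n + rest_perm n == 2 * (4 * m) + rest_sum n | n + rest_perm n == 3 * (4 * m) + rest_sum n]%N.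
  by case/or4P=> /eqP ->; [exists 0%N | exists 1%N | exists 2%N | exists 3%N].
move: dn; rewrite /rest_dom /rest_perm /rest_sum => /and3P[].
by do !case: ifP; lia.
Qed.

Local Notation N := (8 * m)%N.

Let N1 : (1 < N)%N. Proof. by lia. Qed.

Definition Z2N_elt (e v : nat) : 'Z_2 * 'Z_N := (e%:R, v%:R).

Lemma Z2N_eltD e v e' v' : Z2N_elt e v + Z2N_elt e' v' = Z2N_elt (e + e') (v + v').
Proof. by rewrite /Z2N_elt !natrD. Qed.

Lemma Z2N_elt_eq e v e' v' : Z2N_elt e v = Z2N_elt e' v' -> e = e' %[mod 2] /\ v = v' %[mod N].
Proof.
case=> /(congr1 val) /= eq1 /(congr1 (val : 'Z_N -> nat)) eq2; split.
  by move: eq1; rewrite !(@val_Zp_nat 2).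
by move: eq2; rewrite /= !val_Zp_nat.
Qed.

Lemma Z2N_elt0 e v : ~~ odd e -> (N %| v)%N -> Z2N_elt e v = 0.
Proof.
move=> ev /dvdnP[c ->]; apply: injective_projections; apply: val_inj; rewrite /= val_Zp_nat //.
  by rewrite modn2 (negPf ev).
by rewrite modnMl.
Qed.

Definition off_klein : pred ('Z_2 * 'Z_N) := fun u => u.2 *+ 2 != 0.

Lemma off_kleinE e v : off_klein (Z2N_elt e v) = ~~ (4 * m %| v)%N.
Proof.
rewrite /off_klein /= -mulrnA; congr (~~ _).
rewrite -(inj_eq val_inj) /= val_Zp_nat // -/(dvdn N (v * 2)).
by rewrite (_ : N = (4 * m * 2)%N) ?dvdn_pmul2r //; lia.
Qed.

(** Columns 0, 1 and columns 2, 3 carry the residues [n] and [-n], and [tau] tells the two pairs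
    apart. In [y] the first coordinate gives [color + tau], then the second gives [n], and so [tau].
    In [x + y] the first coordinate is the colour, the second modulo [4 * m] is [rest_sum n], so [n]
    is known, and the term [4 * m * (color + tau)] reveals [tau]. *)
Lemma rest_tiles p : prime p -> odd p ->
  tiles (@cylinder ('Z_2 * 'Z_N)%type p off_klein) 0 0 'I_(4 * m).-1 'I_p 'I_4.
Proof.
move=> pr_p oddp.
pose n_ (k : 'I_(4 * m).-1) (j : 'I_4) : nat := if odd j then (N - k.+1)%N else k.+1.
pose tau (j : 'I_4) : bool := (1 < j)%N.
have dn k j : rest_dom (n_ k j).
  by rewrite /rest_dom /n_; have := ltn_ord k; case: ifP; lia.
have n_inj k j k' j' : n_ k j = n_ k' j' -> tau j = tau j' -> k = k' /\ j = j'.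
  rewrite /n_ /tau => eqn eqt; have ltk := ltn_ord k; have ltk' := ltn_ord k'.
  suff [eqk eqj] : k = k' :> nat /\ j = j' :> nat by split; apply: val_inj.
  move: eqn eqt; case: j j' => -[|[|[|[|//]]]] ? [] -[|[|[|[|//]]]] ? //= *; split=> //; lia.
pose x k j := Z2N_elt (tau j) (n_ k j).
pose y k j := Z2N_elt (rest_color (n_ k j) + tau j) (rest_perm (n_ k j) + 4 * m * (rest_color (n_ k j) + tau j)).
have xyE k j : x k j + y k j = Z2N_elt (tau j + (rest_color (n_ k j) + tau j))
   (n_ k j + (rest_perm (n_ k j) + 4 * m * (rest_color (n_ k j) + tau j))).
  by rewrite /x /y Z2N_eltD.
have dv4 : (4 * m %| N)%N by rewrite dvdn_pmul2r.
have modM u v : u = v %[mod N] -> u = v %[mod 4 * m].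
  by move=> eqm; rewrite -(modn_dvdm u dv4) eqm modn_dvdm.
have half_mod s s' : s = s' %[mod 2] -> 4 * m * s = 4 * m * s' %[mod N].
  move=> eqs; rewrite (_ : N = (4 * m * 2)%N); last by lia.
  by rewrite -!muln_modr eqs.
have rest_ndvd n : rest_dom n -> ~~ (4 * m %| n)%N.
  by case/and3P=> n0 ltn neq; apply/negP=> /dvdnP[[|[|c]] defn]; lia.
apply: (@pattern_tiles _ p off_klein _ x y pr_p oddp).
- by move=> u; rewrite /off_klein /= mulNrn oppr_eq0.
- move=> k j k' j' /Z2N_elt_eq[eqt eqn].
  apply: n_inj; last by move: eqt; case: (tau j); case: (tau j').
  have /and3P[_ lt1 _] := dn k j; have /and3P[_ lt2 _] := dn k' j'.
  by move: eqn; rewrite !modn_small.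
- move=> k j k' j' /Z2N_elt_eq[eqt eqn].
  have /rest_perm_inj eqn' : rest_perm (n_ k j) = rest_perm (n_ k' j').
    have /and3P[_ lt1 _] := rest_perm_dom (dn k j).
    have /and3P[_ lt2 _] := rest_perm_dom (dn k' j').
    rewrite -(modn_small lt1) -(modn_small lt2); apply/eqP.
    rewrite -(eqn_modDr (4 * m * (rest_color (n_ k j) + tau j))) eqn.
    by rewrite -modnDmr -(half_mod _ _ eqt) modnDmr.
  have eqnn := eqn' (dn _ _) (dn _ _); apply: n_inj => //; move: eqt; rewrite eqnn.
  by case: (rest_color _); case: (tau j); case: (tau j').
- move=> k j k' j'; rewrite !xyE => /Z2N_elt_eq[eqt eqn].
  have eqc : rest_color (n_ k j) = rest_color (n_ k' j').
    by move: eqt; do 2!case: (rest_color _); case: (tau j); case: (tau j').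
  have eqnn : n_ k j = n_ k' j'.
    apply: rest_sum_inj => //.
    have /andP[_ lt1] := rest_sum_bounds (dn k j); have /andP[_ lt2] := rest_sum_bounds (dn k' j').
    rewrite -(modn_small lt1) -(modn_small lt2) -!rest_sumE //.
    by have := modM _ _ eqn; rewrite !addnA -modnDmr modnMr addn0 -[RHS]modnDmr modnMr addn0.
  apply: n_inj => //; move: eqn; rewrite eqnn => /eqP; rewrite !eqn_modDl.
  rewrite (_ : N = (4 * m * 2)%N) -?muln_modr ?eqn_pmul2l; [|lia..].
  by case: (rest_color _); case: (tau j); case: (tau j').
- move=> k j; rewrite xyE !off_kleinE rest_ndvd //.
  have dvM s : (4 * m %| 4 * m * s)%N by apply: dvdn_mulr.
  rewrite (dvdn_addl _ (dvM _)) rest_ndvd ?rest_perm_dom //=.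
  rewrite addnA (dvdn_addl _ (dvM _)) /dvdn rest_sumE //.
  have /andP[gt0 lt1] := rest_sum_bounds (dn k j).
  by rewrite modn_small // -lt0n.
- move=> k; rewrite /x Z2N_eltD; apply: Z2N_elt0 => //.
  by rewrite /n_ /= addnBCA ?subnn ?addn0 //; have := ltn_ord k; lia.
- move=> k; rewrite /x Z2N_eltD; apply: Z2N_elt0 => //.
  by rewrite /n_ /= addnBCA ?subnn ?addn0 //; have := ltn_ord k; lia.
- move=> k; rewrite /y !Z2N_eltD.
  have [e02 e13] : n_ k 2%:R = n_ k 0 /\ n_ k 3%:R = n_ k 1 by [].
  rewrite e02 e13 /tau /= !addn0.
  rewrite -[LHS]addr0 -(@Z2N_elt0 2 N) // Z2N_eltD; congr Z2N_elt; lia.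
Qed.

End Rest.

(** * Quotients of abelian groups *)

Section Quotients.
Variable G : finZmodType.
Implicit Types (A B C R : {group G}) (x : G).

Lemma mem_joinP A B x :
  reflect (exists2 a, a \in A & x - a \in B) (x \in (A <*> B)%g).
Proof.
rewrite norm_joinEl; last by apply: cents_norm; apply/centsP=> y _ z _; apply: addrC.
apply: (iffP mulsgP) => [[a b Aa Bb ->]|[a Aa Bxa]]; last first.
  by exists a (x - a); rewrite ?FinRing.zmodMgE // addrC subrK.
by exists a; rewrite // FinRing.zmodMgE addrAC subrr add0r.
Qed.

Lemma card_join A B : (forall x, x \in A -> x \in B -> x = 0) ->
  #|(A <*> B)%g| = (#|A| * #|B|)%N.
Proof.
move=> TI; rewrite norm_joinEl; last by apply: cents_norm; apply/centsP=> y _ z _; apply: addrC.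
apply: TI_cardMg; apply/trivgP/subsetP=> x /setIP[Ax Bx].
by rewrite (TI x Ax Bx) inE.
Qed.

Lemma mem_cycleP x y : reflect (exists n, y = x *+ n) (y \in <[x]>%g).
Proof. exact: cycleP. Qed.

Lemma mulrn_eq0_order x n : (x *+ n == 0) = (#[x]%g %| n)%N.
Proof. by rewrite order_dvdn. Qed.

(* tau induces an additive isomorphism from U onto its image modulo C. *)
Definition section_mod (U : zmodType) B C (tau : U -> G) : Prop :=
  [/\ C \subset B, forall u, tau u \in B, sum0_mod C tau
    & forall u v, tau u - tau v \in C -> u = v].

(** [C'] is generated by [x *+ N] and [C]; the quotient of the direct sum of [<[x]>] and [R] by it
    is [Z/N x R/C]. *)
Lemma cycle_quotient R x N :
    (1 < N)%N -> (N %| #[x]%g)%N -> (forall y, y \in <[x]>%g -> y \in R -> y = 0) ->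
  forall C, C \subset R -> exists C' : {group G},
   [/\ C' \subset (<[x]> <*> R)%G, #|C'| = (#[x]%g %/ N * #|C|)%N, x *+ N \in C', C \subset C'
     & forall k r, r \in R -> x *+ k + r \in C' -> (N %| k)%N /\ r \in C].
Proof.
move=> N1 Nx TI C sCR; exists (<[(x *+ N)%R]> <*> C)%G; split.
- rewrite join_subG (subset_trans sCR) ?joing_subr // andbT cycle_subG.
  by apply: (subsetP (joing_subl _ _)); apply: mem_cycle.
- rewrite card_join => [|y /mem_cycleP[n ->] /(subsetP sCR)]; last first.
    by apply: TI; rewrite -mulrnA; apply: mem_cycle.
  congr (_ * _)%N; rewrite -[LHS]/(#[(x ^+ N)%g]%g) orderXdiv //.
- by apply: (subsetP (joing_subl _ _)); apply: cycle_id.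
- exact: joing_subr.
- move=> k r Rr /mem_joinP[a /mem_cycleP[n ->]]; rewrite addrAC -mulrnA => Cr.
  have xkr : x *+ k - x *+ (N * n) = 0.
    apply: TI; first by rewrite memB // mem_cycle.
    by have := subsetP sCR _ Cr; rewrite memDr.
  split; last by rewrite xkr add0r in Cr.
  have : k = N * n %[mod N].
    have := @mulrnB_mem G 1%G x k (N * n) #[x]%g.
    rewrite xkr => /(_ _ (mem0 _)) eqm.
    rewrite -(modn_dvdm k Nx) eqm ?modn_dvdm // => i /set1P/eqP.
    by rewrite mulrn_eq0_order.
  by rewrite modnMr => /eqP.
Qed.

Lemma ltn_Zp N (a : 'Z_N) : (1 < N)%N -> (a < N)%N.
Proof. by move=> N1; rewrite -{2}(Zp_cast N1) ltn_ord. Qed.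

Lemma section_base R x N :
    (1 < N)%N -> (N %| #[x]%g)%N -> (forall y, y \in <[x]>%g -> y \in R -> y = 0) ->
  exists C' : {group G}, [/\ R \subset C', #|C'| = (#[x]%g %/ N * #|R|)%N, x *+ N \in C'
     & section_mod (<[x]> <*> R)%G C' (fun a : 'Z_N => x *+ a)].
Proof.
move=> N1 Nx TI; have [C' [sC'B cardC' C'x sRC' injC']] := cycle_quotient N1 Nx TI (subxx R).
exists C'; split=> //; split=> //.
- by move=> a; apply: (subsetP (joing_subl _ _)); apply: mem_cycle.
- exact: sum0_mod_Zp.
- move=> a b Cab; apply: val_inj.
  suff : a = b %[mod N] by rewrite !modn_small ?ltn_Zp.
  apply: (mulrnB_mem _ Cab) => n Cn.
  by have [] := injC' n 0 (mem0 _); rewrite ?addr0.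
Qed.

Lemma section_step (U : zmodType) B C (tau : U -> G) x N :
    (1 < N)%N -> (N %| #[x]%g)%N -> (forall y, y \in <[x]>%g -> y \in B -> y = 0) ->
    section_mod B C tau ->
  exists C' : {group G}, [/\ C \subset C', #|C'| = (#[x]%g %/ N * #|C|)%N, x *+ N \in C'
     & section_mod (<[x]> <*> B)%G C' (fun u : U * 'Z_N => tau u.1 + x *+ u.2)].
Proof.
move=> N1 Nx TI [sCB tauB tau0 injtau].
have [C' [sC'B cardC' C'x sCC' injC']] := cycle_quotient N1 Nx TI sCB.
exists C'; split=> //; split=> //.
- move=> [u a] /=; apply: memD; first by apply: (subsetP (joing_subr _ _)).
  by apply: (subsetP (joing_subl _ _)); apply: mem_cycle.
- apply: (sum0_mod_pair (psi1 := tau) (psi2 := fun a : 'Z_N => x *+ a)); last exact: sum0_mod_Zp.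
  by move=> I a a0; apply: (subsetP sCC'); apply: tau0.
- move=> [u a] [v b] /=; rewrite opprD addrACA addrC.
  wlog leba : u v a b / (b <= a)%N => [wlg|].
    have [leba|/ltnW leab] := leqP b a; first exact: wlg.
    by rewrite -memN opprD !opprB => /wlg-> //.
  rewrite -mulrnBr // => Cuv.
  have [|Nab /injtau <-] := injC' _ _ _ Cuv; first by rewrite memB.
  congr pair; apply: val_inj.
  by move: Nab; rewrite -eqn_mod_dvd // => /eqP; rewrite !modn_small ?ltn_Zp.
Qed.

(* The subgroup C of index p in C_T is generally not a direct factor; replacing tau by p * tau turns it into a section modulo C, while o generates C_T modulo C. *)
Lemma section_tileable (U : zmodType) C_T (tau : U -> G) p n c :
    section_mod [set: G]%G C_T tau -> prime p -> odd p ->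
    #|G| = (#|C_T| * 2 ^ n)%N -> (p %| #|C_T|)%N ->
    (forall C, C \subset C_T -> #|C_T| = (#|C| * p)%N -> zero_sum_bij3 C) ->
    tiles (@cylinder U p xpredT) 0 0 'I_c 'I_p 'I_4 ->
  tileable G p 4 (c * (#|C_T| %/ p)).
Proof.
move=> [_ _ tau0 injtau] pr_p oddp cardG pC hp tU.
have [C sC cardC] := subgroup_prime_index pr_p pC.
have [o Co oC] := prime_index_proper pr_p sC cardC.
have Cop := prime_index_mul sC cardC Co.
have p0 := prime_gt0 pr_p.
(* Multiplication by [p] is injective on [G / C_T], whose order is a power of 2. *)
have half y : y *+ p \in C_T -> y \in C_T.
  have index2 : #|[set: G]%G : C_T|%g = (2 ^ n)%N.
    by apply/eqP; rewrite -(eqn_pmul2l (cardG_gt0 C_T)) Lagrange ?subsetT // cardsT cardG.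
  have := index_mul_mem (subsetT C_T) (in_setT y); rewrite index2 => Cy2 Cyp.
  have /coprimeP[|[u v] /= uv] : coprime (2 ^ n) p; first 1 last.
  - by rewrite expn_gt0.
  - have : y *+ (u * 2 ^ n - v * p) \in C_T.
      rewrite mulrnBr; last by lia.
      by apply: memB; rewrite mulnC mulrnA memMn.
    by rewrite uv.
  - by case: (n) => [|n']; rewrite ?coprime1n // coprime_pexpl // coprime2n.
pose psi (u : U * 'F_p) := tau u.1 *+ p + o *+ u.2.
have psi0 : sum0_mod C psi.
  apply: (sum0_mod_pair (psi1 := fun u => tau u *+ p) (psi2 := fun a : 'F_p => o *+ a)).
    move=> I a a0; rewrite sumrMnl; apply: (prime_index_mul sC cardC).
    exact: tau0.
  exact: sum0_mod_Fp.
have inj_psi u v : psi u - psi v \in C -> u = v.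
  case: u v => [u a] [v b]; rewrite /psi /= opprD addrACA -mulrnBl => Cuv.
  have equv : u = v.
    apply: injtau; apply: half; have := subsetP sC _ Cuv.
    by rewrite memDr // memB ?memMn.
  move: Cuv; rewrite equv subrr mul0rn add0r => Cab; congr pair.
  have eqab : a = b %[mod p].
    by apply: (mulrnB_mem _ Cab) => k; rewrite (mulrn_mem_prime _ pr_p).
  by rewrite -[a]natr_Zp -[b]natr_Zp; apply/val_inj; rewrite /= !val_Fp_nat.
have tG := @transfer_tiles G _ _ C psi _ _ _ psi0 inj_psi tU.
have := tileableP (tG _ _ _); rewrite card_prod !card_ord cardC mulnK //; apply=> //.
by apply: bij_table_ge2 => //; [apply: hp | apply: prime_gt1].
Qed.

End Quotients.

Lemma map_tiles (U W : zmodType) (S : pred U) (S' : pred W) (psi : U -> W) (K I J : finType) :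
    (forall (X : finType) (a : X -> U), \sum_i a i = 0 -> \sum_i psi (a i) = 0) ->
    injective psi -> (forall u, S u -> S' (psi u)) ->
  tiles S 0 0 K I J -> tiles S' 0 0 K I J.
Proof.
move=> psi0 injpsi SS' [F [injF FS rowF colF]].
exists (fun k i j => psi (F k i j)); split=> [k i j k' i' j' /injpsi/injF|k i j|k i|k j] //.
- exact/SS'/FS.
- exact: psi0.
- exact: psi0.
Qed.

(** The Klein subgroup consists of the pairs [(a, 4 * m * b)] and supplies the one array missing
    from [rest_tiles]. *)
Lemma Z2N_tiles p m : prime p -> odd p -> (0 < m)%N ->
  tiles (@cylinder ('Z_2 * 'Z_(8 * m))%type p xpredT) 0 0 'I_(4 * m) 'I_p 'I_4.
Proof.
move=> pr_p oddp m0; pose N := (8 * m)%N; have N1 : (1 < N)%N by rewrite /N; lia.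
pose T := ('Z_2 * 'Z_N)%type.
have NR0 k : (N * k)%:R = 0 :> 'Z_N by apply: val_inj; rewrite /= val_Zp_nat // modnMr.
pose psi (u : 'Z_2 * 'Z_2 * 'F_p) : T * 'F_p := ((u.1.1, (4 * m * u.1.2)%:R), u.2).
have tK : tiles (@cylinder T p (predC (@off_klein m))) 0 0 'I_1 'I_p 'I_4.
  apply: (map_tiles (psi := psi)) (klein_tiles pr_p oddp) => [X a a0|u v|u _]; last first.
  - have h : (4 * m * u.1.2)%:R *+ 2 = 0 :> 'Z_N.
      have -> : (4 * m * u.1.2)%:R *+ 2 = (N * u.1.2)%:R :> 'Z_N by rewrite -mulrnA /N; congr _%:R; lia.
      exact: NR0.
    by apply/negPn/eqP; exact: h.
  - move: u v => [[a b] l] [[a' b'] l'] [-> /(congr1 (val : 'Z_N -> nat)) /= + ->].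
    rewrite !val_Zp_nat // (_ : N = (4 * m * 2)%N); last by rewrite /N; lia.
    by rewrite -!muln_modr !modn_small ?(ltn_Zp (N := 2)) // => /eqP; rewrite eqn_pmul2l ?muln_gt0 // => /eqP/val_inj->.
  - have a1 := congr1 fst a0; have a2 := congr1 snd a0.
    rewrite raddf_sum /= in a2; rewrite raddf_sum /= in a1.
    have a11 := congr1 fst a1; have a12 := congr1 snd a1.
    rewrite raddf_sum /= in a11; rewrite raddf_sum /= in a12.
    apply: injective_projections; rewrite raddf_sum //=.
    apply: injective_projections; rewrite raddf_sum //= -natr_sum -big_distrr /=.
    have /dvdnP[c ->] : (2 %| \sum_i (a i).1.2)%N.
      apply/eqP; rewrite -(@val_Zp_nat 2) // natr_sum (eq_bigr (fun i => (a i).1.2)) ?a12 //.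
      by move=> i _; apply: natr_Zp.
    have -> : (4 * m * (c * 2) = N * c)%N by rewrite /N; lia.
    exact: NR0.
have [|F [injF _ rowF colF]] := tilesU _ (rest_tiles m0 pr_p oddp) tK.
  by move=> u; rewrite /cylinder /= => ->.
apply: (@tiles_reindex _ xpredT 0 0 _ _ _ 'I_(4 * m) 'I_p 'I_4 _ erefl erefl); last by exists F; split.
by rewrite card_sum !card_ord; lia.
Qed.

(** * Choice of the quotient for arrays with four columns *)

Section EvenOrder.
Variable G : finZmodType.

Lemma klein_pair_order2 (w z : G) : #[w]%g = 2 -> #[z]%g = 2 -> w <> z -> klein_pair w z.
Proof.
move=> ow oz /eqP wz; rewrite /klein_pair wz.
rewrite !mulrn_eq0_order ow oz -[w == 0]/(w == 1%g) -[z == 0]/(z == 1%g).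
by rewrite -!order_eq1 ow oz.
Qed.

Lemma klein_sub (w z : G) (wz : klein_pair w z) (C : {group G}) :
  w \in C -> z \in C -> klein_group wz \subset C.
Proof.
move=> Cw Cz; apply/subsetP=> x /(klein_eltP wz)[a [b ->]].
by rewrite memD ?memMn.
Qed.

Definition klein_or_odd (C : {group G}) : Prop :=
  odd #|C| \/ exists2 w : G, w \in C & exists2 z : G, z \in C & klein_pair w z.

Lemma klein_or_odd_bij3 (C : {group G}) : klein_or_odd C -> zero_sum_bij3 C.
Proof.
case=> [|[w Cw [z Cz wz]]]; first exact: zero_sum_bij3_odd.
exact: zero_sum_bij3_klein (klein_sub wz Cw Cz).
Qed.

Lemma klein_or_odd_sub (C D : {group G}) n :
  C \subset D -> #|D| = (#|C| * n)%N -> odd n -> klein_or_odd D -> klein_or_odd C.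
Proof.
move=> sCD cardD oddn [oddD|[w Dw [z Dz wz]]].
  by left; move: oddD; rewrite cardD oddM => /andP[].
have mem2 x : x \in D -> x *+ 2 = 0 -> x \in C.
  move=> Dx x2; have := prime_index_mul sCD cardD Dx.
  by rewrite -(odd_double_half n) oddn mulrnDr -mul2n mulrnA x2 mul0rn addr0.
case/and5P: (wz) => _ _ _ /eqP w2 /eqP z2.
by right; exists w; [exact: mem2 | exists z; [exact: mem2 |]].
Qed.

End EvenOrder.

Lemma Z2pow_tiles p k : prime p -> odd p ->
  tiles (@cylinder ('Z_2 * 'Z_(2 ^ k.+1))%type p xpredT) 0 0 'I_(2 ^ k) 'I_p 'I_4.
Proof.
move=> pr_p oddp; case: k => [|[|[|k]]].
- exact: klein_tiles.
- exact: Z24_tiles.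
- exact: (@Z2N_tiles p 1).
- have -> : (2 ^ k.+4 = 8 * 2 ^ k.+1)%N := expnD 2 3 k.+1.
  have -> : (2 ^ k.+3 = 4 * 2 ^ k.+1)%N := expnD 2 2 k.+1.
  by apply: Z2N_tiles; rewrite ?expn_gt0.
Qed.

Lemma muln_halves u v r n : (u * (2 * n) * (v * 2 * r) = u * (v * r) * (4 * n))%N.
Proof. by lia. Qed.

Lemma muln_halves3 u v w r : (u * 2 * (v * 2 * (w * 2 * r)) = u * (v * (w * r)) * (4 * 2))%N.
Proof. by lia. Qed.

Section TwoRank.
Variable G : finZmodType.
Implicit Types (R : {group G}) (x : G).

Definition indep x R : Prop := forall y, y \in <[x]>%g -> y \in R -> y = 0.

(** The first terms of an invariant factor decomposition. The alternatives in the tail separate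
    2-rank exactly 2 ([R] odd), exactly 3 ([R'] odd) and at least 4. *)
Definition even_rank2 : Prop := exists x1 x2 R,
  [/\ indep x1 (<[x2]> <*> R)%G, indep x2 R, [set: G]%G = (<[x1]> <*> (<[x2]> <*> R))%G,
      (#[x2]%g %| #[x1]%g)%N /\ (2 %| #[x2]%g)%N
    & odd #|R| \/ exists x3 R', [/\ indep x3 R', R = (<[x3]> <*> R')%G,
         (#[x3]%g %| #[x2]%g)%N /\ (2 %| #[x3]%g)%N
       & odd #|R'| \/ exists2 t, t \in R' & #[t]%g = 2]].

Lemma order_half x : (2 %| #[x]%g)%N -> #[(x *+ (#[x]%g %/ 2))%R]%g = 2.
Proof.
move=> x2; have x0 := order_gt0 x.
have h0 : (0 < #[x]%g %/ 2)%N by rewrite divn_gt0 // dvdn_leq.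
have def : #[x]%g = (2 * (#[x]%g %/ 2))%N by rewrite mulnC divnK.
rewrite -[LHS]/(#[(x ^+ _)%g]%g) orderXdiv; last by rewrite {2}def dvdn_mull.
by rewrite {1}def mulnK.
Qed.

Lemma half_mem x N (C : {group G}) :
  (2 %| #[x]%g)%N -> (2 * N %| #[x]%g)%N -> x *+ N \in C -> x *+ (#[x]%g %/ 2) \in C.
Proof.
move=> x2 /dvdnP[k def] Cx.
by rewrite def mulnCA mulKn // mulnC mulrnA memMn.
Qed.

Lemma order2_neq (w z : G) R x : #[w]%g = 2 -> w \in <[x]>%g -> z \in R -> indep x R -> w <> z.
Proof.
move=> ow xw Rz ix eqwz; have w0 : w = 0 by apply: ix; rewrite // eqwz.
by move: ow; rewrite w0 -[0]/(1%g : G) order1.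
Qed.

Lemma tileable_section (U : zmodType) C_T (tau : U -> G) p n c c' :
    section_mod [set: G]%G C_T tau -> prime p -> odd p -> #|G| = (p * 4 * c)%N ->
    #|G| = (#|C_T| * (4 * c'))%N -> (4 * c' = 2 ^ n)%N -> klein_or_odd C_T ->
    tiles (@cylinder U p xpredT) 0 0 'I_c' 'I_p 'I_4 ->
  tileable G p 4 c.
Proof.
move=> secC pr_p oddp cardG cardC defn koC tU.
have pC : (p %| #|C_T|)%N.
  have : (p %| #|C_T| * 2 ^ n)%N by rewrite -defn -cardC cardG -mulnA dvdn_mulr.
  by rewrite Gauss_dvdl //; case: (n) => [|n']; rewrite ?coprimen1 // coprime_pexpr // coprimen2.
have := @section_tileable G U C_T tau p n c' secC pr_p oddp; rewrite -defn => /(_ cardC pC).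
suff -> : (c' * (#|C_T| %/ p) = c)%N.
  by apply=> // C sC cardCT; apply: klein_or_odd_bij3; apply: klein_or_odd_sub sC cardCT oddp koC.
have p0 := prime_gt0 pr_p; case/dvdnP: pC => k defC; rewrite defC mulnK //.
apply/eqP; rewrite -(eqn_pmul2l p0) -(@eqn_pmul2l 4) //; apply/eqP.
have : (k * p * (4 * c') = p * 4 * c)%N by rewrite -defC -cardC.
by lia.
Qed.

Lemma tileable_p4 p c :
    prime p -> odd p -> #|G| = (p * 4 * c)%N -> even_rank2 -> tileable G p 4 c.
Proof.
move=> pr_p oddp cardG [x1 [x2 [R [i1 i2 defG [dv21 dv2] tail]]]].
have dv1 := dvdn_trans dv2 dv21.
have o1 := order_half dv1; have o2 := order_half dv2.
have cardG' : #|G| = (#[x1]%g * (#[x2]%g * #|R|))%N.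
  have -> : #|G| = #|[set: G]%G| by rewrite cardsT.
  by rewrite defG !card_join.
set n1 := #[x1]%g in dv21 dv1 o1 cardG' *; set n2 := #[x2]%g in dv2 dv21 o2 cardG' *.
have n1_gt0 : (0 < n1)%N := order_gt0 x1; have n2_gt0 : (0 < n2)%N := order_gt0 x2.
have [C1 [sRC1 cardC1 C1x2 sec1]] := @section_base G R x2 2 isT dv2 i2.
case: tail => [oddR|[x3 [R' [i3 defR [dv32 dv3] tail]]]].
  pose a1 := logn 2 n1; pose a2 := logn 2 n2.
  have a12 : (a2 <= a1)%N by apply: dvdn_leq_log.
  have a2_gt0 : (0 < a2)%N by rewrite logn_gt0 mem_primes n2_gt0.
  (* The exponent is chosen so that both cyclic factors leave [Z/2^(a2 - 1)] in the kernel: it has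
     odd order if [a2 = 1], and otherwise contains a Klein group. *)
  pose k := (a1 - a2)%N; pose N := (2 ^ k.+1)%N.
  have N1 : (1 < N)%N by rewrite -{1}(expn0 2) ltn_exp2l.
  have dvN : (N %| n1)%N by rewrite pfactor_dvdn // -/a1 /k; lia.
  have [C [sC1C cardC Cx1 sec]] := section_step N1 dvN i1 sec1.
  rewrite -defG in sec.
  have cardGC : #|G| = (#|C| * (4 * 2 ^ k))%N.
    by rewrite cardC cardC1 cardG' -{1}(divnK dvN) -{1}(divnK dv2) {2}/N expnS muln_halves.
  have ko : klein_or_odd C.
    have [a2_1|a2_1] := eqVneq a2 1%N.
      left; rewrite cardC cardC1 !oddM oddR andbT.
      have oddpart n a : (0 < n)%N -> logn 2 n = a -> odd (n %/ 2 ^ a).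
        move=> n0 la; rewrite -[odd _]negbK -dvdn2 -[X in (X %| _)%N]expn1 pfactor_dvdn ?divn_gt0 ?expn_gt0 //.
          by rewrite logn_div ?pfactorK ?la ?subnn // -la pfactor_dvdnn.
        by rewrite -la dvdn_leq // pfactor_dvdnn.
      rewrite (oddpart _ _ n1_gt0) /N; last by rewrite -/a1 /k; lia.
      by rewrite (oddpart n2 1%N).
    right; exists (x1 *+ (n1 %/ 2)).
      by apply: half_mem Cx1 => //; rewrite /N -expnS pfactor_dvdn // -/a1 /k; lia.
    exists (x2 *+ (n2 %/ 2)).
      apply: half_mem (subsetP sC1C _ C1x2) => //.
      by rewrite -[(2 * 2)%N]/(2 ^ 2)%N pfactor_dvdn // -/a2; lia.
    apply: klein_pair_order2 => //; apply: (order2_neq o1 _ _ i1); first exact: mem_cycle.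
    by apply: (subsetP (joing_subl _ _)); apply: mem_cycle.
  apply: (tileable_section (n := k.+2) sec pr_p oddp cardG cardGC _ ko); first by rewrite -(expnD 2 2 k).
  exact: Z2pow_tiles.
have Rx3 : x3 *+ (#[x3]%g %/ 2) \in R.
  by rewrite defR; apply: (subsetP (joing_subl _ _)); apply: mem_cycle.
have o3 := order_half dv3.
have [C [sC1C cardC Cx1 sec]] := @section_step G _ _ _ _ x1 2 isT dv1 i1 sec1.
rewrite -defG in sec.
have sRC := subset_trans sRC1 sC1C.
have cardGC : #|G| = (#|C| * (4 * 1))%N.
  by rewrite cardC cardC1 cardG' -{1}(divnK dv1) -{1}(divnK dv2) -(muln_halves _ _ _ 1).
have tK := klein_tiles pr_p oddp.
(* The kernel of this Klein quotient contains [x1 *+ 2] and [R]. If 4 divides [n1], the involutions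
   of [<[x1]>] and [<[x3]>] both lie in it. *)
have [dv4|ndv4] := boolP (4 %| n1)%N.
  apply: (tileable_section (n := 2) sec pr_p oddp cardG cardGC _ _ tK) => //.
  right; exists (x1 *+ (n1 %/ 2)); first exact: half_mem Cx1.
  exists (x3 *+ (#[x3]%g %/ 2)); first exact: (subsetP sRC).
  apply: klein_pair_order2 => //; apply: (order2_neq o1 _ _ i1); first exact: mem_cycle.
  by apply: (subsetP (joing_subr _ _)).
(* In 2-rank at least 4, the involution of [<[x3]>] and [t] do the same inside [R]. *)
case: tail => [oddR'|[t R't ot]]; last first.
  apply: (tileable_section (n := 2) sec pr_p oddp cardG cardGC _ _ tK) => //.
  right; exists (x3 *+ (#[x3]%g %/ 2)); first exact: (subsetP sRC).
  exists t; first by apply: (subsetP sRC); rewrite defR; apply: (subsetP (joing_subr _ _)).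
  apply: klein_pair_order2 => //; apply: (order2_neq o3 _ R't i3); exact: mem_cycle.
(* There remains the Sylow 2-subgroup [(Z/2)^3]: all three orders are twice an odd number, and the
   whole 2-part goes into the quotient, leaving an odd kernel. *)
have [D1 [_ cardD1 _ secD1]] := @section_base G R' x3 2 isT dv3 i3.
rewrite -defR in secD1.
have [D2 [_ cardD2 _ secD2]] := @section_step G _ _ _ _ x2 2 isT dv2 i2 secD1.
have [D3 [_ cardD3 _ secD3]] := @section_step G _ _ _ _ x1 2 isT dv1 i1 secD2.
rewrite -defG in secD3.
have odd_half n : (n %| n1)%N -> (2 %| n)%N -> odd (n %/ 2).
  move=> dvn /dvdnP[h def]; rewrite def mulnK //; apply: contraR ndv4.
  by rewrite -dvdn2 => /dvdnP[h' def']; apply: dvdn_trans dvn; rewrite def def' -mulnA dvdn_mull.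
have cardR : #|R| = (#[x3]%g * #|R'|)%N by rewrite defR card_join.
have cardGD : #|G| = (#|D3| * (4 * 2))%N.
  rewrite cardD3 cardD2 cardD1 cardG' cardR -{1}(divnK dv1) -{1}(divnK dv2) -{1}(divnK dv3).
  exact: muln_halves3.
apply: (tileable_section (n := 3) secD3 pr_p oddp cardG cardGD _ _ (Z222_tiles pr_p oddp)) => //.
left; rewrite cardD3 cardD2 cardD1 !oddM oddR' andbT !odd_half //.
exact: dvdn_trans dv32 dv21.
Qed.

End TwoRank.

(** * Sufficiency *)

Section Structure.
Variable G : finZmodType.

Lemma odd_bigdprod (b : seq G) (B : {group G}) n :
    \big[dprod/1%g]_(x <- b) <[x]>%g = B -> all (fun x => #[x]%g %| n)%N b -> odd n ->
  odd #|B|.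
Proof.
move=> /bigdprod_card <- /allP dvb oddn; rewrite big_seq.
elim/big_ind: _ => // [u v oddu oddv|x /dvb]; first by rewrite oddM oddu.
by move/dvdn_odd; apply.
Qed.

Lemma dprod_join (A B C : {group G}) :
  (A \x B)%g = C -> C = (A <*> B)%G /\ forall y, y \in A -> y \in B -> y = 0.
Proof.
case/dprodP=> _ mulAB cAB TI; split.
  by apply: val_inj; rewrite /= -mulAB cent_joinEr.
by move=> y Ay By; apply/set1P; rewrite -[[set 0]]/(1%g : {set G}) -TI inE Ay.
Qed.

Lemma sylow2_structure :
  (forall P : {group G}, P \in 'Syl_2([set: G])%g -> P :=: 1%g \/ ~~ cyclic P) ->
  odd #|G| \/ even_rank2 G.
Proof.
move=> syl; have [b defG] := abelian_structure (zabelian [set: G]).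
move=> typb; have sortb := abelian_type_dvdn_sorted [set: G]; rewrite -{}typb in sortb.
case: b => [|x1 b1] in defG sortb.
  by left; rewrite -cardsT -defG big_nil cards1.
rewrite big_cons in defG; have /dprodP[[_ B1 _ defB1] _ _ _] := defG.
rewrite defB1 in defG.
have [defG1 i1] := @dprod_join <[x1]>%G B1 [set: G]%G defG.
have path_dv (x : G) (b : seq G) : sorted [rel m n | n %| m]%N (map order (x :: b)) ->
    all (fun y => #[y]%g %| #[x]%g)%N b.
  move=> /(order_path_min (fun u v w duv dvw => dvdn_trans dvw duv)).
  by rewrite all_map.
(* If [B1] has odd order, a Sylow 2-subgroup of [<[x1]>] is one of [G]; being cyclic, it is trivial
   by hypothesis. *)
have [oddB|evenB] := boolP (odd #|B1|).
  left; have [Q sylQ] := Sylow_exists 2 <[x1]>%G.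
  have cardGx : #|G| = (#[x1]%g * #|B1|)%N.
    by have := card_join i1; rewrite -[(<[x1]> <*> B1)%g]/(gval (<[x1]> <*> B1)%G) -defG1 cardsT.
  have partB : (#|B1|`_2 = 1)%N by rewrite part_p'nat // p'natE // dvdn2 oddB.
  have cardQ : #|Q| = (#|G|`_2)%N.
    by rewrite (card_Hall sylQ) cardGx partnM ?cardG_gt0 // partB muln1.
  have /syl[Q1|/negP[]] : Q \in 'Syl_2([set: G])%g.
  - by rewrite inE pHallE subsetT cardsT cardQ eqxx.
  - rewrite -[odd _]negbK -dvdn2 -p'natE // -partn_eq1; last by rewrite -cardsT cardG_gt0.
    by rewrite -cardQ Q1 cards1.
  - by apply: cyclicS (pHall_sub sylQ) (cycle_cyclic _).
right; case: b1 => [|x2 b2] in defB1 sortb.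
  by rewrite -defB1 big_nil cards1 in evenB.
have /andP[dv21 _] := path_dv _ _ sortb; have /= /andP[_ sortb2] := sortb.
rewrite big_cons in defB1; have /dprodP[[_ R _ defR] _ _ _] := defB1; rewrite defR in defB1.
have [defB i2] := @dprod_join <[x2]>%G R B1 defB1.
(* All later orders divide [#[x2]], so an odd [#[x2]] would make [B1] odd. *)
have dv2 : (2 %| #[x2]%g)%N.
  rewrite dvdn2; apply: contra evenB => oddx2; rewrite defB card_join // oddM oddx2.
  exact: odd_bigdprod defR (path_dv x2 b2 sortb2) oddx2.
exists x1, x2, R; split; [by rewrite defB in i1 | exact: i2 | by rewrite defB in defG1 | by [] |].
have [oddR|evenR] := boolP (odd #|R|); [by left | right].
case: b2 => [|x3 b3] in defR sortb2 {sortb}.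
  by rewrite -defR big_nil cards1 in evenR.
have /andP[dv32 _] := path_dv x2 (x3 :: b3) sortb2; have /= /andP[_ sortb3] := sortb2.
rewrite big_cons in defR; have /dprodP[[_ R' _ defR'] _ _ _] := defR; rewrite defR' in defR.
have [defR1 i3] := @dprod_join <[x3]>%G R' R defR.
exists x3, R'; split=> //.
  split=> //; rewrite dvdn2; apply: contra evenR => oddx3; rewrite defR1 card_join // oddM oddx3.
  exact: odd_bigdprod defR' (path_dv x3 b3 sortb3) oddx3.
have [oddR'|evenR'] := boolP (odd #|R'|); [by left | right].
by have [|t R't ot] := @Cauchy _ 2 R' isT; [rewrite dvdn2 | exists t].
Qed.

Lemma even_rank2_klein : even_rank2 G -> klein_or_odd [set: G]%G.
Proof.
case=> x1 [x2 [R [i1 i2 _ [dv21 dv2] _]]]; right.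
have dv1 := dvdn_trans dv2 dv21.
exists (x1 *+ (#[x1]%g %/ 2)); rewrite ?inE //; exists (x2 *+ (#[x2]%g %/ 2)); rewrite ?inE //.
apply: klein_pair_order2; rewrite ?order_half //.
apply: (order2_neq (order_half dv1) _ _ i1); first exact: mem_cycle.
by apply: (subsetP (joing_subl _ _)); apply: mem_cycle.
Qed.

(* The arrays are (x, g - x; g + e - x, x + e) with e an involution of a subgroup M of index 2, x in M and g outside M. *)
Lemma tileable_22 n : (0 < n)%N -> #|G| = (2 * 2 * n)%N -> tileable G 2 2 n.
Proof.
move=> n0 cardG.
have [|M sM cardM] := @subgroup_prime_index G [set: G]%G 2 isT.
  by rewrite cardsT cardG -mulnA dvdn_mulr.
have cardM' : #|M| = (2 * n)%N.
  by apply/eqP; rewrite -(@eqn_pmul2r 2) // -cardM cardsT cardG; apply/eqP; lia.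
have [|e Me oe] := @Cauchy _ 2 M isT; first by rewrite cardM' dvdn_mulr.
have [g _ Mg] := prime_index_proper (isT : prime 2) sM cardM.
have e2 : e + e = 0 by apply/eqP; rewrite -mulr2n mulrn_eq0_order oe.
have e0 : e != 0 by rewrite -[e == 0]/(e == 1%g) -order_eq1 oe.
have [||s [Ms injs]] := @coset_reps G <[e]>%G M 'I_n.
- by rewrite cycle_subG.
- by rewrite card_ord cardM' -oe.
exists g, (g + e).
pose F (k : 'I_n) (i j : 'I_2) : G :=
  if i == 0 then (if j == 0 then s k else g - s k)
  else (if j == 0 then g + e - s k else s k + e).
(* Diagonal entries lie in [M], the others outside, so only entries of the same kind can coincide,
   and these reveal the coset of [<[e]>]. *)
have Fe k i j : F k i j = if i == j then s k + e *+ i else g - s k + e *+ i.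
  case: i j => -[|[|//]] ? [] -[|[|//]] ?; rewrite /F /= ?mulr0n ?mulr1n ?addr0 //.
  by rewrite addrAC.
have eC i : e *+ i \in <[e]>%g by apply: mem_cycle.
have eM i : e *+ i \in M by apply: memMn.
have eqI (i i' : 'I_2) : e *+ i = e *+ i' -> i = i'.
  case: i i' => -[|[|//]] ? [] -[|[|//]] ?; rewrite /= ?mulr0n ?mulr1n => /eqP.
  - by move=> _; apply: val_inj.
  - by rewrite eq_sym (negPf e0).
  - by rewrite (negPf e0).
  - by move=> _; apply: val_inj.
exists F; split=> //.
- move=> k i j k' i' j'; rewrite !Fe.
  have MF x i1 : x \in M -> g - x + e *+ i1 \notin M.
    by move=> Mx; rewrite memDr // memDr ?memN.
  have same (y y' : G) : y + e *+ i = y' + e *+ i' -> y - y' \in <[e]>%g.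
    move=> eqy; rewrite (_ : y - y' = e *+ i' - e *+ i) ?memB //.
    by apply/eqP; rewrite subr_eq addrAC eq_sym subr_eq eqy addrC.
  have eqj (x y x' y' : 'I_2) : x = x' -> (x == y) = (x' == y') -> y = y'.
    move=> <-; case: x y y' => -[|[|//]] ? [] -[|[|//]] ? [] -[|[|//]] ? //= _;
      exact: val_inj.
  case: (boolP (i == j)) => ij; case: (boolP (i' == j')) => ij' eqF.
  + have eqk := injs _ _ (same _ _ eqF); move: eqF; rewrite eqk => /addrI/eqI eqi.
    by split=> //; apply: (eqj i _ i') => //; rewrite ij ij'.
  + by have := MF (s k') i' (Ms k'); rewrite -eqF memD.
  + by have := MF (s k) i (Ms k); rewrite eqF memD.
  + have eqk : k = k'.
      by apply/esym/injs; have := same _ _ eqF; rewrite opprB addrC subrKA.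
    move: eqF; rewrite eqk => /addrI/eqI eqi.
    by split=> //; apply: (eqj i _ i') => //; rewrite (negPf ij) (negPf ij').
- move=> k i; rewrite !big_ord_recl big_ord0 addr0 /F /=; case: ifP => _.
    by rewrite addrC subrK.
  by rewrite addrA subrK -addrA e2 addr0.
- move=> k j; rewrite !big_ord_recl big_ord0 addr0 /F /=; case: ifP => _.
    by rewrite addrC subrK.
  by rewrite addrA subrK.
Qed.

Lemma tileable_grow a b c u v : tileable G a b (c * v * u) -> tileable G (u * a) (v * b) c.
Proof. by move/tileable_stack/tileable_tr/tileable_stack/tileable_tr. Qed.

Lemma tileable_even a b c :
    (0 < a)%N -> (0 < b)%N -> (0 < c)%N -> ~~ odd a -> ~~ odd b -> #|G| = (a * b * c)%N ->
  tileable G a b c.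
Proof.
move=> a0 b0 c0 eva evb cardG.
rewrite -(even_halfK eva) -(even_halfK evb) -!muln2.
apply/tileable_grow/tileable_22; first by rewrite !muln_gt0 c0 !half_gt0; lia.
by rewrite cardG -{1}(even_halfK eva) -{1}(even_halfK evb) -!muln2; lia.
Qed.

(** With [p] an odd prime factor of [a], blocks [p x 4] are stacked if 4 divides [b]. Otherwise [b]
    or [b / 2] is odd and greater than 1, and an odd prime factor [q] of it gives blocks [p x q]. *)
Lemma tileable_odd a b c :
    (1 < a)%N -> (1 < b)%N -> (0 < c)%N -> odd a -> b != 2 -> #|G| = (a * b * c)%N ->
    odd #|G| \/ even_rank2 G ->
  tileable G a b c.
Proof.
move=> a1 b1 c0 odda b2 cardG str.
have ko : klein_or_odd [set: G]%G.
  by case: str => [oddG|/even_rank2_klein//]; left; rewrite cardsT.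
have pr_p := pdiv_prime a1; set p := pdiv a in pr_p.
have oddp : odd p by apply: dvdn_odd (pdiv_dvd a) odda.
have /dvdnP[a' defa] : (p %| a)%N := pdiv_dvd a.
have oddq q b' : prime q -> odd q -> b = (b' * q)%N -> tileable G a b c.
  move=> pr_q oddq defb; rewrite defa defb; apply: tileable_grow.
  apply: tileable_odd_primes => //; first by rewrite cardG defa defb; lia.
  move=> C cardC; apply: klein_or_odd_bij3; apply: klein_or_odd_sub (subsetT C) _ _ ko.
    by rewrite cardsT; exact: cardC.
  by rewrite oddM oddp.
have [/dvdnP[b' defb]|b4] := boolP (4 %| b)%N.
  rewrite defa defb; apply: tileable_grow; apply: tileable_p4 => //.
    by rewrite cardG defa defb; lia.
  by case: str => // ; rewrite cardG defb !oddM !andbF.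
have oddb q : prime q -> odd q -> (q %| b)%N -> tileable G a b c.
  by move=> pr_q oq /dvdnP[b' /oddq]; apply.
have [ob|eb] := boolP (odd b).
  by apply: (oddb (pdiv b)); rewrite ?pdiv_prime ?pdiv_dvd ?(dvdn_odd (pdiv_dvd b)).
have defb := even_halfK eb; have ob2 : odd b./2.
  apply: contraR b4 => eb2; rewrite -defb -(even_halfK eb2) -!muln2 -mulnA.
  exact: dvdn_mull.
have b21 : (1 < b./2)%N by lia.
apply: (oddb (pdiv b./2)); rewrite ?pdiv_prime ?(dvdn_odd (pdiv_dvd _)) //.
by apply: dvdn_trans (pdiv_dvd _) _; rewrite -{2}defb -muln2 dvdn_mulr.
Qed.

End Structure.

(** * Necessity *)

Section Necessity.
Variable G : finZmodType.

Lemma is_MRS_tr a b c (M : 'I_c -> 'M[G]_(a, b)) : is_MRS M -> is_MRS (fun k => (M k)^T).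
Proof.
case=> uniqM [gam rowM] [del colM]; split.
- move=> g; have [[[k i] j] [/= eqg uniq]] := uniqM g.
  exists (k, j, i); split=> [|[[k' j'] i'] /=]; rewrite /= mxE // => eqg'.
  by have [-> -> ->] := uniq (k', i', j') eqg'.
- by exists del => k j; rewrite -(colM k j); apply: eq_bigr => i _; rewrite mxE.
- by exists gam => k i; rewrite -(rowM k i); apply: eq_bigr => j _; rewrite mxE.
Qed.

Lemma MRS_two_rows b c (M : 'I_c -> 'M[G]_(2, b)) : is_MRS M -> ~~ odd b.
Proof.
case=> uniqM [gam rowM] [del colM]; apply/negP=> oddb.
have [[[k0 i0] j0] _] := uniqM 0.
have col2 k j : M k 0 j + M k 1 j = del.
  by rewrite -(colM k j) !big_ord_recl big_ord0 addr0; congr (_ + M k _ j); apply: val_inj.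
have sumcol : gam + gam = del *+ b.
  rewrite -{1}(rowM k0 0) -(rowM k0 1) -big_split /=.
  by under eq_bigr do rewrite col2; rewrite sumr_const card_ord.
(* As [b] is odd, [2 gam = b del] can be solved for [del] as a double. *)
pose x := gam - del *+ b./2.
have defdel : del = x + x.
  rewrite /x addrACA sumcol -opprD -mulrnDr addnn -{1}(odd_double_half b) oddb.
  by rewrite mulrnDr addrK.
have [[[k i] j] [/= eqx uniq]] := uniqM x.
have other : M k (1 - i) j = x.
  have : M k i j + M k (1 - i) j = del.
    rewrite -(col2 k j); case: i {uniq eqx} => -[|[|//]] ?.
      by congr (M k _ j + M k _ j); apply: val_inj.
    by rewrite addrC; congr (M k _ j + M k _ j); apply: val_inj.
  by rewrite eqx defdel => /addrI.
have [eqi] := uniq (k, 1 - i, j) other.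
by move: (congr1 val eqi); case: i {uniq eqx other eqi} => -[|[|//]].
Qed.

Lemma sum_eq_involution (iota : G) : iota != 0 -> iota + iota = 0 ->
  (forall g : G, g + g = 0 -> g = 0 \/ g = iota) -> \sum_(g : G) g = iota.
Proof.
move=> iota0 iota2 uniq; rewrite (bigID (fun g => g + g == 0)) /=.
have -> : \sum_(g : G | g + g == 0) g = iota.
  rewrite (bigD1 iota) ?iota2 //= big1 ?addr0 // => g /andP[/eqP/uniq[//|->]].
  by rewrite eqxx.
(* Ranks select one element from each remaining pair [g], [- g]; negation maps this half onto the
   other, so the two sums cancel. *)
pose r (g : G) := enum_rank g.
rewrite (bigID (fun g => (r g < r (- g))%N)) /= [X in _ + (_ + X)](reindex_inj oppr_inj) /=.
rewrite [X in _ + (_ + X)](eq_bigl (fun g => (g + g != 0) && (r g < r (- g))%N)); last first.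
  move=> g; rewrite -opprD oppr_eq0 opprK -leqNgt; case: eqP => //= g2.
  rewrite leq_eqVlt; case: eqP => //= /val_inj/enum_rank_inj eqg.
  by case: g2; rewrite {2}eqg addrN.
by rewrite sumrN addrN addr0.
Qed.

Lemma MRS_odd_sylow a b c (M : 'I_c -> 'M[G]_(a, b)) (P : {group G}) :
  #|G| = (a * b * c)%N -> is_MRS M -> odd a -> P \in 'Syl_2([set: G])%g ->
  P :=: 1%g \/ ~~ cyclic P.
Proof.
move=> cardG [uniqM _ [del colM]] odda; rewrite inE => sylP.
have [->|ntP] := eqVneq P 1%G; [by left | right; apply/negP=> cycP].
have pP := pHall_pgroup sylP.
have [|_ dvP _] := pgroup_pdiv pP; first by [].
have [iota Piota oiota] := @Cauchy _ 2 P isT dvP.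
have iota0 : iota != 0 by rewrite -[iota == 0]/(iota == 1%g) -order_eq1 oiota.
have iota2 : iota + iota = 0 by apply/eqP; rewrite -mulr2n mulrn_eq0_order oiota.
have sumG : \sum_(g : G) g = iota.
  apply: sum_eq_involution => // g /eqP; rewrite -mulr2n mulrn_eq0_order => og.
  have [->|g0] := eqVneq g 0; [by left | right].
  have {}og : #[g]%g = 2.
    by apply/eqP; move: og; rewrite dvdn_divisors // !inE order_eq1 (negPf g0).
  have Pg : g \in P.
    by rewrite (mem_normal_Hall sylP) ?subg_norm ?subsetT ?inE // /p_elt og.
  have : g \in <[iota]>%g.
    have : (<[g]> == <[iota]>)%g.
      by rewrite (eq_subG_cyclic cycP) ?cycle_subG // -!orderE og oiota.
    by move/eqP <-; apply: cycle_id.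
  case/mem_cycleP=> n defg; move: g0; rewrite defg -(odd_double_half n) mulrnDr -mul2n mulrnA.
  by rewrite mulr2n iota2 mul0rn addr0; case: (odd n); rewrite ?mulr0n ?eqxx.
have inj_f : injective (fun p : 'I_c * 'I_a * 'I_b => M p.1.1 p.1.2 p.2).
  move=> p p' eqp; have [q [_ uniq]] := uniqM (M p.1.1 p.1.2 p.2).
  by rewrite -(uniq p erefl) (uniq p' (esym eqp)).
have bij_f : bijective (fun p : 'I_c * 'I_a * 'I_b => M p.1.1 p.1.2 p.2).
  by apply: inj_card_bij inj_f _; rewrite !card_prod !card_ord cardG; lia.
have sumG' : \sum_(g : G) g = del *+ (c * b).
  rewrite (reindex _ (onW_bij _ bij_f)) /= -(pair_bigA _ (fun ki j => M ki.1 ki.2 j)) /=.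
  rewrite -(pair_bigA _ (fun k i => \sum_j M k i j)) /=.
  under eq_bigr => k _ do (rewrite exchange_big /=; under eq_bigr do rewrite colM).
  by rewrite !sumr_const !card_ord -mulrnA mulnC.
have : iota *+ a = 0.
  rewrite -sumG sumG' -mulrnA; apply/eqP; rewrite mulrn_eq0_order.
  rewrite (_ : c * b * a = #|G|)%N ?cardG; last by lia.
  by rewrite -cardG -cardsT order_dvdG ?inE.
by move/eqP; rewrite mulrn_eq0_order oiota dvdn2 odda.
Qed.

End Necessity.

Close Scope ring_scope.

Theorem theorem1p6 (a b c : nat) (G : finZmodType)
    (ha : 1 < a) (hb : 1 < b) (hc : 0 < c) (hG : #|G| = a * b * c) :
  (exists M : 'I_c -> 'M[G]_(a, b), is_MRS M) <->
  ((a = 0 %[mod 2] /\ b = 0 %[mod 2]) \/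
   (forall P : {group G}, P \in 'Syl_2([set: G])%g -> P :=: 1%g \/ ~~ cyclic P)) /\
  (a = 2 \/ b = 2 -> a * b = 0 %[mod 4]).
Proof.
have even_mod n : (n = 0 %[mod 2]) <-> ~~ odd n.
  by rewrite modn2 mod0n; split=> [/eqP|/negPf->] //; rewrite eqb0.
split=> [[M MRS_M]|[cond1 cond2]].
  have MRS_MT := is_MRS_tr MRS_M; split; last first.
    have dvd22 n : ~~ odd n -> 2 * n = 0 %[mod 4].
      by move/even_halfK <-; rewrite -muln2 mulnCA; apply: modnMl.
    case=> eq2; subst; first exact: dvd22 (MRS_two_rows MRS_M).
    by rewrite mulnC; apply: dvd22 (MRS_two_rows MRS_MT).
  have [odda|eva] := boolP (odd a).
    by right=> P; apply: MRS_odd_sylow hG MRS_M odda.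
  have [oddb|evb] := boolP (odd b); last by left; rewrite !even_mod.
  by right=> P; apply: MRS_odd_sylow MRS_MT oddb; rewrite hG [b * a]mulnC.
apply: (tileable_MRS hG); have [a0 b0] : 0 < a /\ 0 < b by lia.
have odd_case a' b' : 1 < a' -> 1 < b' -> odd a' -> #|G| = a' * b' * c ->
    (b' = 2 -> a' * b' = 0 %[mod 4]) ->
    (forall P : {group G}, P \in 'Syl_2([set: G])%g -> P :=: 1%g \/ ~~ cyclic P) ->
  tileable G a' b' c.
  move=> a1 b1 odda cardG cond4 syl; apply: tileable_odd => //; last exact: sylow2_structure.
  (* For [b' = 2], condition (ii) would make [a'] even. *)
  apply/eqP=> b2; have := cond4 b2; rewrite b2; move: odda; lia.
have [odda|eva] := boolP (odd a).
  apply: odd_case => // [b2|]; first by apply: cond2; right.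
  by case: cond1 => // -[/even_mod]; rewrite odda.
have [oddb|evb] := boolP (odd b); last exact: tileable_even.
apply/tileable_tr/odd_case => //; first by rewrite hG [b * a]mulnC.
  by move=> a2; rewrite mulnC; apply: cond2; left.
by case: cond1 => // -[_ /even_mod]; rewrite oddb.
Qed.
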